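(* Let $K$ be an imaginary quadratic field with discriminant $D_K$, let $\ell\geq3$ be a prime, and let $\mathcal O_0$ be an order in $K$ of conductor $c$ coprime to $\ell$. (a) If $\ell$ is split or inert in $K$, then $\operatorname{rk}(S_1)=\operatorname{rk}(S_0)$, $\operatorname{rk}(S_2)\in\{\operatorname{rk}(S_0),\operatorname{rk}(S_0)+1\}$, and $\operatorname{rk}(S_d)=\operatorname{rk}(S_2)$ for all $d\geq2$. (b) If $\ell$ is ramified in $K$ and either $\ell\geq5$ or ($\ell=3$ and $D_K\equiv3\bmod9$), then $\operatorname{rk}(S_1)\in\{\operatorname{rk}(S_0),\operatorname{rk}(S_0)+1\}$ and $\operatorname{rk}(S_d)=\operatorname{rk}(S_1)$ for all $d\geq1$. (c) If $\ell=3$ is ramified in $K$ and $D_K\equiv6\bmod9$, then $\operatorname{rk}(S_1)\in\{\operatorname{rk}(S_0),\operatorname{rk}(S_0)+1\}$, $\operatorname{rk}(S_2)\in\{\operatorname{rk}(S_1),\operatorname{rk}(S_1)+1\}$, and $\operatorname{rk}(S_d)=\operatorname{rk}(S_2)$ for all $d\geq2$.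
   Context: For $d\geq0$, $\mathcal O_d$ is the order of conductor $c\ell^d$ in $K$ and $S_d$ is the Sylow $\ell$-subgroup of its class group $\operatorname{Cl}(\mathcal O_d)$ (proper fractional ideals modulo principal ideals). For a finite abelian $\ell$-group $S$, $\operatorname{rk}(S)=\dim_{\mathbf F_\ell}S[\ell]$, the number of cyclic factors of $S$. *)

(* Defs.v *)
From HB Require Import structures.
From mathcomp Require Import all_boot all_order all_fingroup all_algebra.
From mathcomp Require Import all_solvable all_field.
From mathcomp Require Import boolp classical_sets generic_quotient.
From mathcomp Require Import ring lra zify.
Set Implicit Arguments.
Unset Strict Implicit.
Unset Printing Implicit Defensive.
Import Order.TTheory GRing.Theory Num.Theory.
Local Open Scope ring_scope.


(* K = Q(s) where s is a square root of the negative rational q. *)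
Structure imQuadField := ImQuadField {
  iq_sort :> fieldExtType rat;
  iq_dim : \dim {: iq_sort} = 2%N;
  iq_imag : exists s : iq_sort, exists2 q : rat, q < 0 & s ^+ 2 = q%:A
}.

Lemma zsub (H : int -> Prop) : H 0 -> (forall x y, H x -> H y -> H (x - y)) ->
  exists d : nat, forall x, H x <-> (d %| x)%Z.
Proof.
move=> H0 HB.
have HN x : H x -> H (- x) by move=> hx; rewrite -sub0r; apply: HB.
have HD x y : H x -> H y -> H (x + y) by move=> hx hy; rewrite -[y]opprK; apply: HB => //; apply: HN.
have HMn x (k : nat) : H x -> H (x *+ k) by move=> hx; elim: k => // k ih; rewrite mulrS; apply: HD.
have HM x (k : int) : H x -> H (k * x).
  move=> hx; rewrite mulrC -mulrzz; case: k => k.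
    by rewrite -pmulrn; apply: HMn.
  by rewrite NegzE -nmulrn; apply/HN/HMn.
have Habs x : H x -> H (absz x)%:Z by move=> hx; rewrite abszE; case: (ger0P x) => _ //; apply: HN.
case: (pselect (exists n : nat, (0 < n)%N /\ H n%:Z)) => [ex|nex].
  have ex' : exists n, (0 < n)%N && `[< H n%:Z >].
    by case: ex => n [n0 hn]; exists n; rewrite n0; apply/asboolP.
  exists (ex_minn ex'); case: ex_minnP => d /andP[d0 /asboolP hd] dmin x; split; last first.
    by case/dvdzP=> k ->; apply: HM.
  move=> hx; apply/dvdz_mod0P; apply/eqP; rewrite -absz_eq0; apply/negPn/negP => rn0.
  have hr : H (absz (x %% d)%Z)%:Z.
    by apply: Habs; rewrite /modz; apply: HB => //; apply: HM.
  have := dmin _ (introT andP (conj _ (introT (asboolP _) hr))).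
  rewrite lt0n rn0 => /(_ isT).
  have := ltz_pmod x (d:=d%:Z); have := @modz_ge0 x d%:Z; lia.
exists 0%N => x; rewrite dvd0z; split; last by move/eqP->.
move=> hx; apply/eqP; apply: contra_notP nex => x0; exists (absz x); split; last exact: Habs.
by rewrite absz_gt0; apply/eqP.
Qed.

Section Coord.
Variable K : imQuadField.
Local Notation ia := (in_alg K).

Lemma iaZ (m : int) : ia m%:~R = m%:~R.
Proof. by rewrite rmorph_int. Qed.
Lemma iaD a b : ia (a + b) = ia a + ia b. Proof. exact: rmorphD. Qed.
Lemma iaB a b : ia (a - b) = ia a - ia b. Proof. exact: rmorphB. Qed.
Lemma iaN a : ia (- a) = - ia a. Proof. exact: rmorphN. Qed.
Lemma iaM a b : ia (a * b) = ia a * ia b. Proof. exact: rmorphM. Qed.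
Lemma iaV a : ia a^-1 = (ia a)^-1. Proof. exact: fmorphV. Qed.
Lemma iaX a k : ia (a ^+ k) = ia a ^+ k. Proof. exact: rmorphXn. Qed.
Lemma iaR (k : nat) : ia k%:R = k%:R. Proof. exact: rmorph_nat. Qed.
Lemma ia0 : ia 0 = 0. Proof. exact: rmorph0. Qed.
Definition iaE := (iaD, iaB, iaN, iaM, iaV, iaX, ia0, iaR, iaZ).
Lemma ia_inj : injective ia. Proof. exact: fmorph_inj. Qed.

Lemma iq_coord : exists s : K, exists2 q : rat, q < 0 & [/\ s ^+ 2 = ia q,
  (forall x : K, exists u v : rat, x = ia u + ia v * s) &
  (forall u v u' v', ia u + ia v * s = ia u' + ia v' * s -> u = u' /\ v = v')].
Proof.
case: (iq_imag K) => s [q q0 sq]; exists s, q => //.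
have inj0 u v : ia u + ia v * s = 0 -> u = 0 /\ v = 0.
  move=> e; have [v0|v0] := eqVneq v 0.
    by split=> //; apply/ia_inj; move: e; rewrite v0 rmorph0 mul0r addr0.
  exfalso.
  have es : ia v ^+ 2 * s ^+ 2 = ia u ^+ 2.
    have -> : ia u = - (ia v * s) by apply/eqP; rewrite -addr_eq0 e.
    by rewrite sqrrN exprMn.
  move: es; rewrite sq -[q%:A]/(ia q) -!rmorphXn -rmorphM => /ia_inj es.
  have : v ^+ 2 * q < 0 by rewrite pmulr_rlt0 // exprn_even_gt0.
  by rewrite es ltNge sqr_ge0.
split=> //.
- move=> x.
  have fr : free [:: 1; s].
    rewrite (perm_free (Y := [:: s; 1])); last by rewrite (perm_catC [:: 1] [:: s]).
    rewrite free_cons span_seq1 seq1_free oner_eq0 andbT.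
    apply/negP => /vlineP [k e].
    have := inj0 k (-1); rewrite rmorphN1 mulN1r e subrr.
    by case=> // _ /eqP; rewrite oppr_eq0 oner_eq0.
  have bs : basis_of {: K} [:: 1; s].
    by rewrite basisEfree fr subvf /= iq_dim.
  have := coord_basis (X := [tuple 1; s]) bs (memvf x).
  rewrite !big_ord_recl big_ord0 /= addr0 => ->.
  do 2!eexists.
  by rewrite -[X in X + _]mulr_algl -[X in _ + X]mulr_algl mulr1.
- move=> u v u' v' e; have : ia (u - u') + ia (v - v') * s = 0.
    rewrite !rmorphB /= mulrBl addrACA -opprD; apply/eqP; rewrite subr_eq0; exact/eqP.
  by case/inj0 => /eqP h1 /eqP h2; split; apply/eqP; rewrite -subr_eq0.
Qed.
End Coord.


(* A subring of K that is finitely generated as a Z-module and contains a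
   Q-basis of K. *)
Structure quadOrder (K : imQuadField) := QuadOrder {
  qo_set :> K -> Prop;
  qo1 : qo_set 1;
  qoB : forall x y, qo_set x -> qo_set y -> qo_set (x - y);
  qoM : forall x y, qo_set x -> qo_set y -> qo_set (x * y);
  qo_fg : exists g : seq K, forall x, qo_set x <->
    exists a : nat -> int, x = \sum_(i < size g) g`_i *~ a i;
  qo_basis : exists2 b : seq K, basis_of {: K} b & forall x, x \in b -> qo_set x
}.

Section AddSub.
Variables (V : zmodType) (A : set V).
Hypothesis (A0 : exists x, A x) (AB : forall x y, A x -> A y -> A (x - y)).
Lemma add_sub0 : A 0. Proof. by case: A0 => x hx; rewrite -(subrr x); apply: AB. Qed.
Lemma add_subN x : A x -> A (- x).
Proof. by move=> hx; rewrite -sub0r; apply: AB => //; apply: add_sub0. Qed.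
Lemma add_subD x y : A x -> A y -> A (x + y).
Proof. by move=> hx hy; rewrite -[y]opprK; apply: AB => //; apply: add_subN. Qed.
Lemma add_subMz x (k : int) : A x -> A (x *~ k).
Proof.
have H (n : nat) z : A z -> A (z *+ n).
  by move=> hz; elim: n => [|n ih]; [apply: add_sub0 | rewrite mulrS; apply: add_subD].
move=> hx; case: k => k; first by rewrite -pmulrn; apply: H.
by rewrite NegzE -nmulrn; apply/add_subN/H.
Qed.
End AddSub.

Lemma wco_id (F : fieldType) (u v s n e a : F) : n != 0 -> e != 0 ->
  u + v * s = u - v * n / e * (a / n) + v * n / e * (a / n + e / n * s).
Proof. by move=> n0 e0; field; rewrite n0. Qed.

Section Ord.
Variables (K : imQuadField) (O : quadOrder K).
Local Notation ia := (in_alg K).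

Lemma qo0 : O 0. Proof. by apply: add_sub0 (@qoB _ O); exists 1; apply: qo1. Qed.
Lemma qoN x : O x -> O (- x).
Proof. by apply: add_subN (@qoB _ O) _; exists 1; apply: qo1. Qed.
Lemma qoD x y : O x -> O y -> O (x + y).
Proof. by apply: add_subD (@qoB _ O) _ _; exists 1; apply: qo1. Qed.
Lemma qoMz x k : O x -> O (x *~ k).
Proof. by apply: add_subMz (@qoB _ O) _ _; exists 1; apply: qo1. Qed.
Lemma qoZ (k : int) : O k%:~R.
Proof. by apply: qoMz; apply: qo1. Qed.
Lemma qoX x (k : nat) : O x -> O (x ^+ k).
Proof. by move=> hx; elim: k => [|k ih]; rewrite ?exprS; [apply: qo1 | apply: qoM]. Qed.

Lemma qo_denom (s : K) : (forall x : K, exists u v : rat, x = ia u + ia v * s) ->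
  exists2 N : nat, (0 < N)%N & forall x, O x ->
     exists a b : int, N%:R * x = a%:~R + b%:~R * s.
Proof.
move=> co; case: (qo_fg O) => g gO.
pose P (N : nat) x := exists a b : int, N%:R * x = a%:~R + b%:~R * s.
have PM N (M : nat) x : P N x -> P (M * N)%N x.
  case=> a [b e]; exists (a * M), (b * M); rewrite natrM -mulrA e !intrM -!pmulrn; ring.
have [N N0 hN] : exists2 N : nat, (0 < N)%N & forall x, x \in g -> P N x.
  elim: {gO}g => [|x g [N N0 ih]]; first by exists 1%N.
  case: (co x) => u [v e].
  pose M := (absz (denq u) * absz (denq v))%N.
  exists (M * N)%N; first by rewrite !muln_gt0 N0 !absz_gt0 !denq_eq0.
  move=> y; rewrite inE => /orP[/eqP->|/ih]; last exact: PM.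
  rewrite mulnC; apply: PM; exists (numq u * denq v), (numq v * denq u).
  have nE (w : rat) : ia w * (denq w)%:~R = (numq w)%:~R.
    by rewrite -!iaZ -rmorphM /= numqE.
  have aE (w : rat) : (absz (denq w))%:R = (denq w)%:~R :> K.
    by rewrite pmulrn abszE gtr0_norm ?denq_gt0.
  by rewrite natrM !aE e !intrM -!nE; ring.
exists N => // x /gO [a ->]; apply: (@big_ind _ (P N)).
- by exists 0, 0; rewrite mulr0 mul0r addr0.
- move=> y z [c [d e]] [c' [d' e']]; exists (c + c'), (d + d').
  by rewrite mulrDr e e' !rmorphD /=; ring.
- move=> i _; have /hN [c [d e]] : g`_i \in g by apply: mem_nth.
  exists (c * a i), (d * a i); rewrite -mulrzl mulrCA e !intrM; ring.
Qed.

Lemma rat_denom (N : nat) (r : rat) : (0 < N)%N ->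
  (forall k, exists a : int, N%:R * r ^+ k = a%:~R) -> exists m : int, r = m%:~R.
Proof.
move=> N0 H; suff d1 : denq r = 1 by exists (numq r); rewrite -[LHS]divq_num_den d1 divr1.
have dv k : (absz (denq r) ^ k %| N)%N.
  case: (H k) => a; rewrite -{1}[r]divq_num_den expr_div_n => e.
  have {}e : N%:Z * numq r ^+ k = a * denq r ^+ k.
    apply: (@intr_inj rat); rewrite !rmorphM !rmorphXn /= -pmulrn -e.
    by field; rewrite expf_neq0 // intr_eq0 denq_neq0.
  have := congr1 absz e; rewrite !abszM !abszX => e'.
  have : (absz (denq r) ^ k %| N * absz (numq r) ^ k)%N.
    by move: e'; rewrite absz_nat => ->; apply: dvdn_mull.
  rewrite Gauss_dvdl // coprimeXl // coprimeXr // coprime_sym; exact: coprime_num_den.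
have := dvdn_leq N0 (dv N); have := denq_gt0 r.
move=> d0 le; case: (ltnP 1 (absz (denq r))) => [h|]; last by lia.
by have := ltn_expl N h; rewrite ltnNge le.
Qed.

Lemma qo_struct : exists (w : K) (t n : int),
  [/\ forall x, O x <-> exists a b : int, x = a%:~R + b%:~R * w,
      w ^+ 2 = t%:~R * w - n%:~R, t ^+ 2 < 4 * n,
      forall x : K, exists u v : rat, x = ia u + ia v * w &
  (forall u v u' v', ia u + ia v * w = ia u' + ia v' * w -> u = u' /\ v = v')].
Proof.
case: (iq_coord K) => s [q q0 [sq co inj]].
case: (qo_denom co) => N N0 hN.
have NK : N%:R != 0 :> K.
  by rewrite pmulrn -iaZ fmorph_eq0 intr_eq0; lia.
have NE : N%:R = ia N%:R :> K by rewrite rmorph_nat.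
pose H b := exists a : int, O ((a%:~R + b%:~R * s) / N%:R).
have [e he] : exists e : nat, forall b, H b <-> (e %| b)%Z.
  apply: zsub; first by exists 0; rewrite mul0r addr0 mul0r; apply: qo0.
  move=> b b' [a h] [a' h']; exists (a - a').
  have -> : ((a - a')%:~R + (b - b')%:~R * s) / N%:R =
    (a%:~R + b%:~R * s) / N%:R - (a'%:~R + b'%:~R * s) / N%:R :> K.
    by rewrite !rmorphB /= -mulrBl; congr (_ / _); ring.
  exact: qoB.
have OQ (r : rat) : O (ia r) -> exists m : int, r = m%:~R.
  move=> hr; apply: (rat_denom N0) => k.
  have /hN [a [b eq]] : O (ia (r ^+ k)) by rewrite rmorphXn; apply: qoX.
  exists a; have := inj (N%:R * r ^+ k) 0 a%:~R b%:~R.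
  by rewrite iaM iaR ia0 mul0r addr0 eq !iaZ; case.
have eN0 : e != 0%N.
  apply/negP => /eqP e0; case: (qo_basis O) => b bb bO.
  have inQ x : x \in b -> x \in <[1 : K]>%VS.
    move=> /bO hx; case: (hN _ hx) => a [c eq].
    have /he : H c by exists a; rewrite -eq mulrC mulKf.
    rewrite e0 dvd0z => /eqP c0; apply/vlineP; exists (a%:~R / N%:R).
    have -> : (a%:~R / N%:R)%:A = ia (a%:~R / N%:R) by [].
    rewrite !iaE; apply: (mulfI NK).
    by rewrite eq c0 mul0r addr0 mulrC divfK.
  have : ({: K} <= <[1 : K]>)%VS.
    by rewrite -(span_basis bb); apply/span_subvP.
  by move/dimvS; rewrite iq_dim dim_vline oner_eq0.
have [a0] : H e by apply/he/dvdzz.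
set w := _ / _ => wO.
have wE : w = ia (a0%:~R / N%:R) + ia (e%:~R / N%:R) * s.
  by rewrite !iaE /w; ring.
have e0 : (e%:~R : rat) != 0 by rewrite intr_eq0; lia.
have NQ0 : (N%:R : rat) != 0 by rewrite pnatr_eq0; lia.
have OE x : O x <-> exists a b : int, x = a%:~R + b%:~R * w.
  split; last by case=> a [b ->]; apply: qoD (qoZ _) _; apply: qoM => //; apply: qoZ.
  move=> hx; case: (hN _ hx) => a [b eq].
  have /he/dvdzP [k bE] : H b by exists a; rewrite -eq mulrC mulKf.
  have h : O (x - k%:~R * w) by apply: qoB => //; apply: qoM => //; apply: qoZ.
  have xE : x = (a%:~R + b%:~R * s) / N%:R by rewrite -eq mulrC mulKf.
  case: (OQ ((a%:~R - k%:~R * a0%:~R) / N%:R)).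
    suff -> : ia ((a%:~R - k%:~R * a0%:~R) / N%:R) = x - k%:~R * w by [].
    rewrite !iaE xE bE /w intrM; ring.
  move=> m mE; exists m, k; rewrite -iaZ -mE.
  rewrite !iaE xE bE /w intrM; ring.
have wco (x : K) : exists u v : rat, x = ia u + ia v * w.
  case: (co x) => u [v ->]; pose c := v * N%:R / e%:~R.
  exists (u - c * (a0%:~R / N%:R)), c; rewrite wE.
  have e0' : (e%:~R : K) != 0 by rewrite -iaZ fmorph_eq0.
  by rewrite /c !iaE; apply: wco_id.
have winj u v u' v' : ia u + ia v * w = ia u' + ia v' * w -> u = u' /\ v = v'.
  rewrite wE => eq.
  case: (inj (u + v * (a0%:~R / N%:R)) (v * (e%:~R / N%:R)) (u' + v' * (a0%:~R / N%:R)) (v' * (e%:~R / N%:R))).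
    by move: eq; rewrite !iaE !mulrDr !addrA !mulrA.
  move=> h1 /mulIf h2; have vv : v = v' by apply: h2; rewrite mulf_neq0 ?invr_eq0.
  by split=> //; move: h1; rewrite vv => /addIr.
have /OE [n' [t w2]] : O (w ^+ 2) by apply: qoX.
exists w, t, (- n'); split=> //.
  by rewrite w2 rmorphN /= opprK addrC.
set A : rat := a0%:~R / N%:R in wE; set E : rat := e%:~R / N%:R in wE.
have EN0 : E != 0 by rewrite mulf_neq0 // invr_eq0.
clearbody A E; move: w2; clearbody w => w2.
have [h1 h2] : A ^+ 2 + E ^+ 2 * q = n'%:~R + t%:~R * A /\ 2 * A * E = t%:~R * E.
  apply: inj; move: w2; rewrite wE -[n'%:~R]iaZ -[t%:~R]iaZ => w2.
  transitivity ((ia A + ia E * s) ^+ 2); first last.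
    by rewrite w2 !iaE /=; ring.
  by rewrite sqrrD exprMn sq !iaE ; ring.
move/(mulIf EN0): h2 => h2.
have : E ^+ 2 * q < 0 by rewrite pmulr_rlt0 // exprn_even_gt0.
rewrite -(ltr_int rat) rmorphXn rmorphM rmorphN /=.
by nra.
Qed.

End Ord.


Section IntRing.
Variable R : pzRingType.
Implicit Types a b : int.
Lemma zD a b : (a + b)%:~R = a%:~R + b%:~R :> R. Proof. exact: rmorphD. Qed.
Lemma zB a b : (a - b)%:~R = a%:~R - b%:~R :> R. Proof. exact: rmorphB. Qed.
Lemma zN a : (- a)%:~R = - a%:~R :> R. Proof. exact: rmorphN. Qed.
Lemma zM a b : (a * b)%:~R = a%:~R * b%:~R :> R. Proof. exact: rmorphM. Qed.
Lemma zX a k : (a ^+ k)%:~R = a%:~R ^+ k :> R. Proof. exact: rmorphXn. Qed.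
Definition zE := (zD, zB, zN, zM, zX).
End IntRing.

Section Smul.
Variable K : fieldExtType rat.
Implicit Types A B C : set K.

(* The additive group generated by the products a * b, a in A and b in B. *)
Definition smul A B : set K := fun x =>
  exists2 s : seq (K * K), (forall p, p \in s -> A p.1 /\ B p.2) &
    x = \sum_(p <- s) p.1 * p.2.

Definition addsub A := A 0 /\ forall x y, A x -> A y -> A (x - y).

Lemma addsubN A x : addsub A -> A x -> A (- x).
Proof. by case=> A0 AB; apply: add_subN AB x; exists 0. Qed.
Lemma addsubD A x y : addsub A -> A x -> A y -> A (x + y).
Proof. by case=> A0 AB; apply: add_subD AB x y; exists 0. Qed.
Lemma addsubMz A x k : addsub A -> A x -> A (x *~ k).
Proof. by case=> A0 AB; apply: add_subMz AB x k; exists 0. Qed.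
Lemma addsubZ A x (k : int) : addsub A -> A x -> A (k%:~R * x).
Proof. by move=> hA hx; rewrite mulrzl; apply: addsubMz. Qed.

Lemma smul_mem A B a b : A a -> B b -> smul A B (a * b).
Proof.
by move=> ha hb; exists [:: (a, b)]; [move=> p; rewrite inE => /eqP-> | rewrite big_seq1].
Qed.

Lemma smul_ind A B C : addsub C -> (forall a b, A a -> B b -> C (a * b)) ->
  forall x, smul A B x -> C x.
Proof.
move=> hC h x [s hs ->]; rewrite big_seq.
by apply: (big_ind C); [case: hC | move=> *; apply: addsubD | move=> p /hs[]; apply: h].
Qed.

Lemma smul_addsub A B : addsub A -> addsub (smul A B).
Proof.
move=> hA; split; first by exists [::]; rewrite ?big_nil.
move=> x y [s hs ->] [s' hs' ->].
exists (s ++ [seq (- p.1, p.2) | p <- s']).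
  move=> p; rewrite mem_cat => /orP[/hs//|/mapP[q /hs' [h1 h2] ->]]; split=> //=.
  exact: addsubN.
rewrite big_cat big_map /=; congr (_ + _); rewrite -sumrN.
by apply: eq_bigr => p _; rewrite mulNr.
Qed.

Lemma addsub_mulr A c : addsub A -> addsub (fun x => A (x * c)).
Proof. by case=> A0 AB; split=> [|x y hx hy]; rewrite ?mul0r ?mulrBl; auto. Qed.

Lemma smulC A B : smul A B = smul B A.
Proof.
apply/funext => x; apply/propext; split; case=> s hs ->;
 exists [seq (p.2, p.1) | p <- s]; rewrite ?big_map /=;
 by [move=> p /mapP[q /hs [h1 h2] ->]; split | apply: eq_bigr => p _; rewrite mulrC].
Qed.

Lemma smulA A B C : addsub A -> addsub B -> addsub C ->
  smul A (smul B C) = smul (smul A B) C.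
Proof.
have H A' B' C' : addsub A' -> addsub B' -> addsub C' ->
    forall x, smul (smul A' B') C' x -> smul A' (smul B' C') x.
  move=> hA hB hC; have hs : addsub (smul A' (smul B' C')) by apply: smul_addsub.
  apply: smul_ind => // a c ha hc.
  move: a ha; apply: (smul_ind (addsub_mulr c hs)) => a b ha hb.
  by rewrite -mulrA; do 2!apply: smul_mem => //.
move=> hA hB hC; apply/funext => x; apply/propext; split; last exact: H.
rewrite smulC [smul B C]smulC [smul (smul A B) C]smulC [smul A B]smulC; exact: H.
Qed.

End Smul.

Section Ideals.
Variables (K : imQuadField) (O : quadOrder K).
Implicit Types I J P : set K.

(* Nonzero O-submodules of K with a common denominator: as O is Noetherian these
   are the nonzero finitely generated O-submodules of K. *)
Definition fractional I :=
  [/\ exists2 x, I x & x != 0,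
      forall x y, I x -> I y -> I (x - y),
      forall a x, O a -> I x -> I (a * x) &
      exists2 d : K, d != 0 & forall x, I x -> O (d * x)].

(* Proper means that O is the full multiplier ring {a | a I is included in I}. *)
Definition proper_ideal I := forall a, O a <-> forall x, I x -> I (a * x).

Definition colon I : set K := fun x => forall y, I y -> O (x * y).

Lemma qo_addsub : addsub (O : set K).
Proof. by split; [apply: qo0 | apply: qoB]. Qed.

Lemma frac_addsub I : fractional I -> addsub I.
Proof. by case=> [[x hx _] hB _ _]; split=> //; rewrite -(subrr x); apply: hB. Qed.

Lemma smulO I : fractional I -> smul O I = I.
Proof.
move=> fI; apply/funext => x; apply/propext; split.
  by apply: smul_ind (frac_addsub fI) _ x; case: fI.
by move=> hx; rewrite -[x]mul1r; apply: smul_mem => //; apply: qo1.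
Qed.

Lemma frac_smul I J : fractional I -> fractional J -> fractional (smul I J).
Proof.
move=> fI fJ; have aI := frac_addsub fI; have [x0 xB] := smul_addsub J aI.
case: fI fJ => [[x hx nx] hB hM [d nd hd]] [[y hy ny] hB' hM' [e ne he]].
split=> //.
- by exists (x * y); rewrite ?mulf_neq0 //; apply: smul_mem.
- move=> a z ha hz; rewrite mulrC; move: z hz.
  apply: smul_ind => [|u v hu hv]; first exact/addsub_mulr/smul_addsub.
  by rewrite mulrC mulrA; apply: smul_mem => //; apply: hM.
- exists (d * e); first by rewrite mulf_neq0.
  move=> z hz; rewrite mulrC; move: z hz.
  apply: smul_ind => [|u v hu hv]; first exact/addsub_mulr/qo_addsub.
  by rewrite mulrC mulrACA; apply: qoM; auto.
Qed.

Lemma colon_frac I : fractional I -> fractional (colon I).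
Proof.
move=> fI; have := fI; case=> [[x hx nx] hB hM [d nd hd]]; split.
- by exists d.
- by move=> u v hu hv y hy; rewrite mulrBl; apply: qoB; auto.
- by move=> a z ha hz y hy; rewrite -mulrA; apply: qoM; auto.
- by exists x => // y hy; rewrite mulrC; apply: hy.
Qed.

Lemma zsubz (H : int -> Prop) : H 0 -> (forall x y, H x -> H y -> H (x - y)) ->
  exists d : int, forall x, H x <-> exists k, x = k * d.
Proof.
move=> h0 hB; case: (zsub h0 hB) => d hd; exists d%:Z => x; rewrite hd.
by split=> [/dvdzP | h]; [|apply/dvdzP].
Qed.

(* Up to scaling, I = aZ + (b + w)Z with O = Z[w] and w^2 = t w - n, and
   then a divides N(b + w) = a c; properness of I amounts to gcd(a, 2b + t, c) = 1,
   whence 1 is in I (O : I). *)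
Lemma proper_inv_int I : fractional I -> proper_ideal I ->
  (forall x, I x -> O x) -> smul I (colon I) 1.
Proof.
move=> fI pI IO; have aI := frac_addsub fI.
have aS : addsub (smul I (colon I)) by apply: smul_addsub.
case: fI => [[z0 hz0 nz0] hB hM _].
case: (qo_struct O) => w [t [n [OE w2 disc co inj]]].
have wO : O w by apply/OE; exists 0, 1; rewrite mul1r add0r.
have injZ (a b a' b' : int) : a%:~R + b%:~R * w = a'%:~R + b'%:~R * w -> a = a' /\ b = b'.
  move=> h; case: (inj a%:~R b%:~R a'%:~R b'%:~R); first by rewrite !iaZ.
  by move=> /intr_inj -> /intr_inj ->.
have [e he] : exists e : int, forall y, (exists x : int, I (x%:~R + y%:~R * w)) <-> exists k, y = k * e.
  apply: zsubz; first by exists 0; rewrite mul0r addr0; case: aI.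
  move=> y y' [x h] [x' h']; exists (x - x').
  have -> : (x - x')%:~R + (y - y')%:~R * w = (x%:~R + y%:~R * w) - (x'%:~R + y'%:~R * w).
    by rewrite !zE; ring.
  exact: hB.
have [a0 ha0] : exists a : int, forall x : int, I x%:~R <-> exists k, x = k * a.
  apply: zsubz; first by case: aI.
  by move=> x y hx hy; rewrite !zE; apply: hB.
have IZ : exists2 m : int, m != 0 & I m%:~R.
  have /OE [x [y E]] := IO _ hz0.
  exists (x ^+ 2 + t * (x * y) + n * y ^+ 2).
    apply/eqP => N0; have [y0|y0] := eqVneq y 0; last first.
      have : 0 < (4 * n - t ^+ 2) * y ^+ 2.
        by rewrite mulr_gt0 ?subr_gt0 // exprn_even_gt0.
      have -> : (4 * n - t ^+ 2) * y ^+ 2 =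
        4 * (x ^+ 2 + t * (x * y) + n * y ^+ 2) - (2 * x + t * y) ^+ 2 by ring.
      by rewrite N0 mulr0 sub0r oppr_gt0 ltNge sqr_ge0.
    move: N0; rewrite y0 !mulr0 !addr0 => /eqP; rewrite expf_eq0 /= => /eqP x0.
    by move: nz0; rewrite E x0 y0 mul0r addr0 eqxx.
  have -> : (x ^+ 2 + t * (x * y) + n * y ^+ 2)%:~R = (x%:~R + t%:~R * y%:~R - y%:~R * w) * z0.
    rewrite E !zE.
    have -> : n%:~R = t%:~R * w - w ^+ 2 by rewrite w2; ring.
    by ring.
  by apply: hM => //; apply/OE; exists (x + t * y), (- y); rewrite !zE mulNr.
have a0N : a0 != 0.
  by case: IZ => m m0 /ha0 [k mE]; apply: contraNneq m0 => h; rewrite mE h mulr0.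
have Ia0 : I a0%:~R by apply/ha0; exists 1; rewrite mul1r.
have [a a0E] : exists a : int, a0 = a * e.
  by apply/he; exists 0; rewrite rmorph0 add0r mulrC; apply: hM.
have e0 : e != 0 by apply: contraNneq a0N => h; rewrite a0E h mulr0.
have aN0 : a != 0 by apply: contraNneq a0N => h; rewrite a0E h mul0r.
have [b0 hb0] : exists b0 : int, I (b0%:~R + e%:~R * w) by apply/he; exists 1; rewrite mul1r.
have [b b0E] : exists b : int, b0 = b * e.
  have [k hk] : exists k, b0 + e * t = k * e.
    apply/he; exists (- (e * n)).
    have -> : (- (e * n))%:~R + (b0 + e * t)%:~R * w = w * (b0%:~R + e%:~R * w).
      rewrite mulrDr [w * (_ * w)]mulrCA -expr2 w2 !zE; ring.
    exact: hM.
  by exists (k - t); rewrite mulrBl -hk; ring.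
have {}hb0 : I (e%:~R * (b%:~R + w)).
  by rewrite mulrDr -intrM mulrC -b0E.
have {}Ia0 : I (e%:~R * a%:~R) by rewrite -intrM mulrC -a0E.
have IE x : I x -> exists k m : int, x = e%:~R * (k%:~R * a%:~R + m%:~R * (b%:~R + w)).
  move=> hx; have /OE [u [v E]] := IO _ hx.
  have [m mE] : exists m : int, v = m * e by apply/he; exists u; rewrite -E.
  have : I (u - m * b * e)%:~R.
    have -> : (u - m * b * e)%:~R = x - m%:~R * (e%:~R * (b%:~R + w)).
      rewrite E mE !zE; ring.
    by apply: hB => //; apply: addsubZ.
  move/ha0 => [k kE]; exists k, m.
  have -> : x = (u - m * b * e)%:~R + m%:~R * (e%:~R * (b%:~R + w)).
    rewrite E mE !zE; ring.
  rewrite kE a0E !zE; ring.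
have [c cE] : exists c : int, b ^+ 2 + b * t + n = a * c.
  have : I (e * (b ^+ 2 + b * t + n))%:~R.
    have -> : (e * (b ^+ 2 + b * t + n))%:~R = (b%:~R + t%:~R - w) * (e%:~R * (b%:~R + w)).
      rewrite !zE.
      have -> : n%:~R = t%:~R * w - w ^+ 2 by rewrite w2; ring.
      by ring.
    by apply: hM => //; apply/OE; exists (b + t), (-1); rewrite zD rmorphN1 mulN1r.
  move/ha0 => [k kE]; exists k; apply: (mulfI e0); rewrite kE a0E; ring.
pose g := gcdz (gcdz a (2 * b + t)) c.
have g1 : g = 1.
  have gN0 : g != 0 by rewrite /g !gcdz_eq0 negb_and negb_and aN0.
  have gK : g%:~R != 0 :> K by rewrite -iaZ fmorph_eq0 intr_eq0.
  have [a' aE] : exists a', a = a' * g by apply/dvdzP; rewrite (dvdz_trans (dvdz_gcdl _ _)) ?dvdz_gcdl.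
  have [t' tE] : exists t', 2 * b + t = t' * g by apply/dvdzP; rewrite (dvdz_trans (dvdz_gcdl _ _)) ?dvdz_gcdr.
  have [c' cgE] : exists c', c = c' * g by apply/dvdzP; rewrite dvdz_gcdr.
  have : O ((b%:~R + w) / g%:~R).
    apply/pI => x /IE [k [m ->]].
    have sqE : (b%:~R + w) ^+ 2 = g%:~R * (t'%:~R * (b%:~R + w) - c'%:~R * a%:~R).
      transitivity ((2 * b + t)%:~R * (b%:~R + w) - (a * c)%:~R); last first.
        by rewrite tE cgE !zE; ring.
      rewrite -cE !zE.
      have -> : n%:~R = t%:~R * w - w ^+ 2 by rewrite w2; ring.
      by ring.
    have -> : (b%:~R + w) / g%:~R * (e%:~R * (k%:~R * a%:~R + m%:~R * (b%:~R + w))) =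
       e%:~R * (k%:~R * a%:~R * (b%:~R + w) + m%:~R * (b%:~R + w) ^+ 2) / g%:~R by ring.
    have -> : e%:~R * (k%:~R * a%:~R * (b%:~R + w) + m%:~R * (b%:~R + w) ^+ 2) / g%:~R =
       (k * a' + m * t')%:~R * (e%:~R * (b%:~R + w)) - (m * c')%:~R * (e%:~R * a%:~R).
      apply: (canLR (mulfK gK)); rewrite sqE {1}aE !zE; ring.
    by apply: hB; apply: addsubZ.
  move/OE => [k [m E]].
  have : b%:~R + 1%:~R * w = (g * k)%:~R + (g * m)%:~R * w.
    rewrite mul1r -[LHS](divfK gK) E !zE; ring.
  move/injZ => [_ gm].
  have : (g %| g * m)%Z by rewrite dvdz_mulr.
  rewrite -gm dvdz1 => /eqP ga; have g0 : 0 <= g by [].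
  by clearbody g; move: ga g0; clear; lia.
have [x1 [x2 [x3 xE]]] : exists x1 x2 x3 : int, 1 = x1 * a + x2 * (2 * b + t) + x3 * c.
  case: (Bezoutz (gcdz a (2 * b + t)) c) => u [v]; rewrite -/g g1.
  case: (Bezoutz a (2 * b + t)) => u' [v' <-] uv.
  by exists (u * u'), (u * v'), v; rewrite -[LHS]uv; ring.
have eK : e%:~R != 0 :> K by rewrite -iaZ fmorph_eq0 intr_eq0.
have aK : a%:~R != 0 :> K by rewrite -iaZ fmorph_eq0 intr_eq0.
have bwO : O (b%:~R + w) by apply: qoD => //; apply: qoZ.
have btwO : O (b%:~R + t%:~R - w) by apply: qoB => //; apply: qoD; apply: qoZ.
have prodE : (b%:~R + t%:~R - w) * (b%:~R + w) = a%:~R * c%:~R.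
  rewrite -intrM -cE !zE.
  have -> : n%:~R = t%:~R * w - w ^+ 2 by rewrite w2; ring.
  by ring.
have col1 : colon I e%:~R^-1.
  move=> x /IE [k [m ->]]; rewrite mulKf //.
  by apply: qoD; apply: qoM => //; apply: qoZ.
pose y := (b%:~R + t%:~R - w) / (a%:~R * e%:~R).
have col2 : colon I y.
  move=> x /IE [k [m ->]]; rewrite /y.
  have -> : (b%:~R + t%:~R - w) / (a%:~R * e%:~R) * (e%:~R * (k%:~R * a%:~R + m%:~R * (b%:~R + w))) =
    (e%:~R * (k%:~R * a%:~R * (b%:~R + t%:~R - w) + m%:~R * ((b%:~R + t%:~R - w) * (b%:~R + w)))) / (a%:~R * e%:~R) by ring.
  rewrite prodE.
  have -> : e%:~R * (k%:~R * a%:~R * (b%:~R + t%:~R - w) + m%:~R * (a%:~R * c%:~R)) =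
     (k%:~R * (b%:~R + t%:~R - w) + m%:~R * c%:~R) * (a%:~R * e%:~R) by ring.
  by rewrite mulfK ?mulf_neq0 //; apply: qoD; apply: qoM => //; apply: qoZ.
have -> : 1 = x1%:~R * ((e%:~R * a%:~R) * e%:~R^-1) +
  (x2%:~R * ((e%:~R * (b%:~R + w)) * e%:~R^-1 + (e%:~R * a%:~R) * y)
  + x3%:~R * ((e%:~R * (b%:~R + w)) * y)) :> K.
  have -> : (e%:~R * a%:~R) * e%:~R^-1 = a%:~R :> K by rewrite mulrC mulKf.
  have -> : (e%:~R * (b%:~R + w)) * e%:~R^-1 = b%:~R + w by rewrite mulrC mulKf.
  have -> : (e%:~R * a%:~R) * y = b%:~R + t%:~R - w.
    by rewrite /y mulrC [a%:~R * _]mulrC divfK // mulf_neq0.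
  have -> : (e%:~R * (b%:~R + w)) * y = c%:~R.
    have -> : (e%:~R * (b%:~R + w)) * y = e%:~R * ((b%:~R + t%:~R - w) * (b%:~R + w)) / (a%:~R * e%:~R).
      by rewrite /y; ring.
    rewrite prodE.
    have -> : e%:~R * (a%:~R * c%:~R) = c%:~R * (a%:~R * e%:~R) :> K by ring.
    by rewrite mulfK // mulf_neq0.
  transitivity ((1 : int)%:~R : K); first by [].
  rewrite {1}xE !zE; ring.
do ?[apply: addsubD => //]; apply: addsubZ => //; try (apply: addsubD => //); exact: smul_mem.
Qed.

Lemma frac_scale I (d : K) : d != 0 -> fractional I -> fractional (fun x => I (d * x)).
Proof.
move=> d0 [[x hx nx] hB hM [c nc hc]]; split.
- by exists (d^-1 * x); rewrite ?mulf_neq0 ?invr_eq0 // mulVKf.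
- by move=> y z hy hz; rewrite mulrBr; apply: hB.
- by move=> a z ha hz; rewrite mulrCA; apply: hM.
- by exists (c * d); rewrite ?mulf_neq0 // => y hy; rewrite -mulrA; apply: hc.
Qed.

Lemma proper_scale I (d : K) : d != 0 -> proper_ideal I -> proper_ideal (fun x => I (d * x)).
Proof.
move=> d0 hI a; rewrite hI; split=> h x hx; first by rewrite mulrCA; apply: h.
by rewrite -(mulVKf d0 x) mulrCA; apply: h; rewrite mulVKf.
Qed.

Lemma proper_inv I : fractional I -> proper_ideal I -> smul I (colon I) = O.
Proof.
move=> fI pI.
have aIC : addsub (smul I (colon I)) by exact/smul_addsub/frac_addsub.
have one : smul I (colon I) 1.
  have [_ _ _ [d d0 hd]] := fI.
  have d0' : d^-1 != 0 by rewrite invr_eq0.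
  have := proper_inv_int (frac_scale d0' fI) (proper_scale d0' pI).
  case=> [x hx|s hs ->].
    by rewrite -(mulVKf d0 x); apply: hd.
  rewrite big_seq; apply: (big_ind (smul I (colon I))) => [||p /hs [h1 h2]].
  - by case: aIC.
  - by move=> *; apply: addsubD.
  have -> : p.1 * p.2 = (d^-1 * p.1) * (d * p.2) by rewrite mulrACA mulVf // mul1r.
  apply: smul_mem => // y hy.
  by rewrite -mulrA mulrCA; apply: h2; rewrite mulKf.
apply/funext => x; apply/propext; split.
  apply: smul_ind qo_addsub _ x => a b ha hb; rewrite mulrC; exact: hb.
move=> hx; rewrite -[x]mulr1; case: (frac_smul fI (colon_frac fI)) => _ _ h _; exact: h.
Qed.

Lemma invertible_proper I J : fractional I -> addsub J -> smul I J = O -> proper_ideal I.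
Proof.
move=> fI aJ h a; split; first by case: fI => _ _ hM _ ha x hx; apply: hM.
move=> ha; rewrite -[a]mul1r.
have : smul I J 1 by rewrite h; apply: qo1.
move: 1; apply: smul_ind => [|x y hx hy]; first exact/addsub_mulr/qo_addsub.
rewrite mulrC mulrA -[O _]/((O : set K) _) -h; apply: smul_mem => //; exact: ha.
Qed.

Lemma proper_colon I : fractional I -> proper_ideal I -> proper_ideal (colon I).
Proof.
move=> fI pI; apply: (@invertible_proper _ I); first exact: colon_frac.
  exact: frac_addsub.
by rewrite smulC proper_inv.
Qed.

Lemma proper_smul I J : fractional I -> fractional J -> proper_ideal I -> proper_ideal J ->
  proper_ideal (smul I J).
Proof.
move=> fI fJ pI pJ.
have aI := frac_addsub fI; have aJ := frac_addsub fJ.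
have aI' := frac_addsub (colon_frac fI); have aJ' := frac_addsub (colon_frac fJ).
apply: (@invertible_proper _ (smul (colon J) (colon I))).
- exact: frac_smul.
- exact: smul_addsub.
have aIJ : addsub (smul I J) by apply: smul_addsub.
rewrite (smulA aIJ aJ' aI') -(smulA aI aJ aJ') (proper_inv fJ pJ).
by rewrite [smul I O]smulC smulO // proper_inv.
Qed.

Lemma qo_frac : fractional O.
Proof.
split; [|exact: qoB|exact: qoM|].
  by exists 1; [apply: qo1 | rewrite oner_eq0].
by exists 1; rewrite ?oner_eq0 // => x; rewrite mul1r.
Qed.

Lemma qo_proper : proper_ideal O.
Proof.
move=> a; split=> [ha x|h]; first exact: qoM.
by rewrite -[a]mulr1; apply: h; apply: qo1.
Qed.

End Ideals.


Section PosDef.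
Variables (t n u v : rat).
Hypothesis disc : t ^+ 2 < 4 * n.
Local Notation Q := (u ^+ 2 + t * (u * v) + n * v ^+ 2).
Let sq4 : 4 * Q = (2 * u + t * v) ^+ 2 + (4 * n - t ^+ 2) * v ^+ 2.
Proof. by ring. Qed.
Let d0 : 0 < 4 * n - t ^+ 2. Proof. by rewrite subr_gt0. Qed.
Lemma posdef_ge0 : 0 <= Q.
Proof.
have h1 := sqr_ge0 (2 * u + t * v).
have h2 : 0 <= (4 * n - t ^+ 2) * v ^+ 2 by rewrite mulr_ge0 ?sqr_ge0 // ltW.
by move: h1 h2; move: sq4; lra.
Qed.
Lemma posdef_eq0 : Q = 0 -> u = 0 /\ v = 0.
Proof.
move=> h; have h1 := sqr_ge0 (2 * u + t * v).
have [v0|v0] := eqVneq v 0.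
  split=> //; move: h; rewrite v0 !(mulr0, expr0n) /= ?mulr0 !addr0 => /eqP.
  by rewrite expf_eq0 => /eqP.
have h2 : 0 < (4 * n - t ^+ 2) * v ^+ 2 by rewrite mulr_gt0 // exprn_even_gt0.
by exfalso; move: h1 h2; move: sq4; rewrite h; lra.
Qed.
End PosDef.

Section Class.
Variables (K : imQuadField) (O : quadOrder K).
Local Notation ia := (in_alg K).

Definition principal (P : set K) :=
  exists2 a : K, a != 0 & P = (fun x => exists2 r, O r & x = a * r).

Structure properIdeal := ProperIdeal {
  pid_set :> K -> Prop;
  pid_fractional : fractional O pid_set;
  pid_proper : proper_ideal O pid_set
}.

Lemma pid_inj (I J : properIdeal) : (I : set K) = J -> I = J.
Proof.
case: I J => [I fI pI] [J fJ pJ] /= e; rewrite e in fI pI *.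
by rewrite (Prop_irrelevance fI fJ) (Prop_irrelevance pI pJ).
Qed.

Definition pid_one := ProperIdeal (qo_frac O) (@qo_proper _ O).
Definition pid_mul (I J : properIdeal) := ProperIdeal
  (frac_smul (pid_fractional I) (pid_fractional J))
  (proper_smul (pid_fractional I) (pid_fractional J) (pid_proper I) (pid_proper J)).
Definition pid_inv (I : properIdeal) := ProperIdeal
  (colon_frac (pid_fractional I)) (proper_colon (pid_fractional I) (pid_proper I)).

(* I and J have the same image modulo the principal ideals. *)
Definition pid_equiv (I J : properIdeal) : Prop :=
  exists2 P, principal P & (J : set K) = smul P I.

Lemma pid_equivP (I J : properIdeal) :
  pid_equiv I J <-> exists2 a : K, a != 0 & forall x, J (a * x) <-> I x.
Proof.
have H a : a != 0 ->
    smul (fun x => exists2 r, O r & x = a * r) I = (fun x => I (a^-1 * x)).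
  move=> a0; have fI := pid_fractional I; have aI := frac_addsub fI.
  apply/funext => x; apply/propext; split; last first.
    move=> h; rewrite -(mulVKf a0 x) -[X in X * _]mulr1 ; rewrite -[a * 1]/(a * 1).
    by apply: smul_mem => //; exists 1 => //; apply: qo1.
  move: x; apply: smul_ind => [|u v [r hr ->] hv].
    split=> [|x y]; first by rewrite mulr0; case: aI.
    by rewrite mulrBr; case: aI => _; apply.
  by rewrite -mulrA mulKf //; case: fI => _ _ h _; apply: h.
split=> [[P [a a0 ->]]|[a a0 h]].
  by rewrite H // => ->; exists a => // x; rewrite mulKf.
exists (fun x => exists2 r, O r & x = a * r); first by exists a.
by rewrite H //; apply/funext => x; apply/propext; rewrite -h mulVKf.
Qed.

Lemma pid_equiv_refl I : pid_equiv I I.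
Proof. by apply/pid_equivP; exists 1; rewrite ?oner_eq0 // => x; rewrite mul1r. Qed.
Lemma pid_equiv_sym I J : pid_equiv I J -> pid_equiv J I.
Proof.
move=> /pid_equivP [a a0 h]; apply/pid_equivP; exists a^-1; rewrite ?invr_eq0 // => x.
by rewrite -h mulVKf.
Qed.
Lemma pid_equiv_trans J I L : pid_equiv I J -> pid_equiv J L -> pid_equiv I L.
Proof.
move=> /pid_equivP [a a0 h] /pid_equivP [b b0 h']; apply/pid_equivP.
by exists (b * a); rewrite ?mulf_neq0 // => x; rewrite -mulrA h' h.
Qed.

Lemma pid_equiv_mul I I' J J' :
  pid_equiv I I' -> pid_equiv J J' -> pid_equiv (pid_mul I J) (pid_mul I' J').
Proof.
have mulC A B : pid_mul A B = pid_mul B A by apply: pid_inj; apply: smulC.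
have H A A' B : pid_equiv A A' -> pid_equiv (pid_mul A B) (pid_mul A' B).
  case=> P hP e; exists P => //=; rewrite e -smulA //; last 2 first.
  - exact/frac_addsub/(pid_fractional A).
  - exact/frac_addsub/(pid_fractional B).
  case: hP => a _ ->; split; first by exists 0; rewrite ?mulr0 //; apply: qo0.
  by move=> x y [r hr ->] [s hs ->]; exists (r - s); rewrite ?mulrBr //; apply: qoB.
move=> h1 h2; apply: (pid_equiv_trans (H _ _ J h1)).
by rewrite (mulC I' J) (mulC I' J'); apply: H.
Qed.

Lemma box_map (M : nat) : (0 < M)%N -> exists (b : rat -> 'I_M) (k : rat -> int),
  forall r s, b r = b s -> `|r - s - (k r - k s)%:~R| * M%:R < 1.
Proof.
move=> M0; pose F (r : rat) := Num.floor (r * M%:R).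
have hj r : (absz (F r %% M)%Z < M)%N.
  have := @modz_ge0 (F r) M; have := @ltz_pmod (F r) M; lia.
exists (fun r => Ordinal (hj r)), (fun r => (F r %/ M)%Z) => r s [] e.
have {}e : (F r %% M)%Z = (F s %% M)%Z.
  have := @modz_ge0 (F r) M; have := @modz_ge0 (F s) M; lia.
have Mr0 : 0 <= M%:R :> rat by [].
rewrite -(ger0_norm Mr0) -normrM.
have E : (r - s - ((F r %/ M)%Z - (F s %/ M)%Z)%:~R) * M%:R =
   (r * M%:R - (F r)%:~R) - (s * M%:R - (F s)%:~R) :> rat.
  rewrite {2}(divz_eq (F r) M) {2}(divz_eq (F s) M) e !zE -!pmulrn; ring.
rewrite E ltr_norml.
have h1 := floor_itv (r * M%:R); have h2 := floor_itv (s * M%:R).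
move: h1 h2; rewrite -/(F r) -/(F s) !intrD => /andP[a1 a2] /andP[b1 b2].
apply/andP; split; lra.
Qed.

(* Scaling I by an element of minimal norm, one gets J containing O whose nonzero
   elements have norm at least 1; the pigeonhole principle then bounds J / O. *)
Lemma class_bound : exists2 L : nat, (0 < L)%N &
  forall I : properIdeal, exists2 J : properIdeal, pid_equiv I J &
    (forall x, O x -> J x) /\ (forall x, J x -> O (L%:R * x)).
Proof.
case: (qo_struct O) => w [t [n [OE w2 disc co inj]]].
have /choice [UV UVE] : forall x : K, exists p : rat * rat, x = ia p.1 + ia p.2 * w.
  by move=> x; case: (co x) => u [v e]; exists (u, v).
pose nrm (p : rat * rat) := p.1 ^+ 2 + t%:~R * (p.1 * p.2) + n%:~R * p.2 ^+ 2.
pose N x := nrm (UV x).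
have UVu u v x : x = ia u + ia v * w -> UV x = (u, v).
  by move=> e; have := UVE x; rewrite {1}e => /inj[]; case: (UV x) => a b /= -> ->.
have discQ : t%:~R ^+ 2 < 4 * n%:~R :> rat.
  by move: disc; rewrite -(ltr_int rat) zM zX.
have NM x y : N (x * y) = N x * N y.
  rewrite /N [UV (x * y)](@UVu ((UV x).1 * (UV y).1 - n%:~R * ((UV x).2 * (UV y).2))
     ((UV x).1 * (UV y).2 + (UV x).2 * (UV y).1 + t%:~R * ((UV x).2 * (UV y).2))).
    by rewrite /nrm /=; ring.
  rewrite {1}(UVE x) {1}(UVE y) !iaE.
  have -> : n%:~R = t%:~R * w - w ^+ 2 by rewrite w2; ring.
  ring.
have N0 x : 0 <= N x by exact: posdef_ge0.
have Neq0 x : N x = 0 -> x = 0.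
  move=> /(posdef_eq0 discQ) [e1 e2].
  by rewrite (UVE x) e1 e2 ia0 mul0r addr0.
have NO x : O x -> exists m : nat, N x = m%:R.
  move=> /OE [a [b e]].
  have h : UV x = (a%:~R, b%:~R) by apply: UVu; rewrite !iaZ.
  pose z := a ^+ 2 + t * (a * b) + n * b ^+ 2.
  have zN : N x = z%:~R by rewrite /N h /nrm /z !zE.
  exists (absz z); rewrite zN pmulrn gez0_abs //.
  by rewrite -(ler_int rat) -zN.
have n0 : 0 < n by have := sqr_ge0 t; lia.
pose M := (1 + absz t + absz n)%N.
have M0 : (0 < M)%N by [].
case: (box_map M0) => bx [fl bxP].
have small u v : `|u| * M%:R < 1 -> `|v| * M%:R < 1 -> nrm (u, v) < 1.
  move=> hu hv; rewrite /nrm /=.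
  set A := `|u| * M%:R in hu; set B := `|v| * M%:R in hv.
  have A0 : 0 <= A by rewrite mulr_ge0.
  have B0 : 0 <= B by rewrite mulr_ge0.
  have ME : M%:R = 1 + `|t%:~R| + n%:~R :> rat.
    have tE : (absz t)%:R = `|t%:~R| :> rat by rewrite pmulrn abszE intr_norm.
    have nE : (absz n)%:R = n%:~R :> rat by rewrite pmulrn gez0_abs // ltW.
    by rewrite /M !natrD tE nE.
  have M1 : 1 <= M%:R :> rat by rewrite ler1n.
  have nq : 0 <= n%:~R :> rat by rewrite ler0z ltW.
  have h1 : A ^+ 2 < 1 by rewrite expr_lt1.
  have h2 : B ^+ 2 <= 1 by rewrite expr_le1 // ltW.
  have h3 : A * B <= 1 by rewrite mulr_ile1 // ltW.
  have h4 : t%:~R * (u * v) <= `|t%:~R| * (`|u| * `|v|) by rewrite -!normrM ler_norm.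
  rewrite -[u ^+ 2]real_normK ?num_real // -[v ^+ 2]real_normK ?num_real //.
  rewrite -(@ltr_pM2r _ (M%:R ^+ 2)) ?exprn_gt0 ?mul1r ?ltr0n //.
  have : `|u| ^+ 2 * M%:R ^+ 2 + `|t%:~R| * (A * B) + n%:~R * B ^+ 2 < M%:R ^+ 2.
    apply: (@lt_le_trans _ _ M%:R); last by rewrite expr2 ler_peMr.
    rewrite -exprMn -/A ME.
    have : `|t%:~R| * (A * B) <= `|t%:~R| by rewrite ler_piMr.
    have : n%:~R * B ^+ 2 <= n%:~R by rewrite ler_piMr.
    lra.
  apply: le_lt_trans; rewrite !mulrDl !lerD //.
    have -> : `|t%:~R| * (A * B) = `|t%:~R| * (`|u| * `|v|) * M%:R ^+ 2 by rewrite /A /B; ring.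
    by rewrite ler_pM2r // exprn_gt0 // ltr0n.
  by rewrite -mulrA -exprMn.
exists ((M * M)`!)%N; first exact: fact_gt0.
move=> I; have fI := pid_fractional I.
have [[x0 hx0 nx0] hB hM [d d0 hd]] := fI.
have exm : exists m : nat, `[< exists2 x, I x & x != 0 /\ N (d * x) = m%:R >].
  by have [m mE] := NO _ (hd _ hx0); exists m; apply/asboolP; exists x0.
case: (ex_minnP exm) => m /asboolP [x hx [nx mE]] mmin.
have Jf := frac_scale nx fI; have Jp := proper_scale nx (pid_proper I).
pose J := ProperIdeal Jf Jp; exists J.
  by apply/pid_equivP; exists x^-1; rewrite ?invr_eq0 // => y /=; rewrite mulVKf.
have OJ y : O y -> J y by move=> hy /=; rewrite mulrC; apply: hM.
have aJ := frac_addsub Jf.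
split=> // z Jz.
have Jbig y : J y -> N y < 1 -> y = 0.
  move=> Jy Ny; apply/eqP; apply: contraTT Ny => ny; rewrite -leNgt.
  have [k kE] := NO _ (hd _ Jy).
  have /mmin : `[< exists2 x, I x & x != 0 /\ N (d * x) = k%:R >].
    by apply/asboolP; exists (x * y); rewrite ?mulf_neq0.
  rewrite -(ler_nat rat) -kE -mE mulrA [N (d * x * y)]NM.
  have dx : 0 < N (d * x).
    rewrite lt_neqAle N0 andbT eq_sym; apply/eqP => /Neq0 /eqP.
    by rewrite mulf_eq0 (negPf d0) (negPf nx).
  by rewrite -{1}[N (d * x)]mulr1 ler_pM2l.
pose f (i : 'I_(M * M).+1) := let p := UV (i%:R * z) in (bx p.1, bx p.2).
have /injectivePn [i [j ij fij]] : ~~ injectiveb f.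
  apply/injectiveP => /leq_card; by rewrite card_prod !card_ord ltnn.
wlog lij : i j ij fij / (i < j)%N => [hw|].
  case: (ltngtP i j) => h; first exact: (hw i j).
  - by apply: (hw j i) => //; rewrite eq_sym.
  - by move: ij; rewrite (ord_inj h) eqxx.
have Jnat (k : nat) : J (k%:R * z) by rewrite pmulrn; apply: addsubZ.
have : O ((j - i)%N%:R * z).
  have := UVE (i%:R * z); have := UVE (j%:R * z); move: fij; rewrite /f /=.
  case: (UV (i%:R * z)) (UV (j%:R * z)) => [u v] [u' v'] /= [b1 b2] e' e.
  have o : O ((fl u' - fl u)%:~R + (fl v' - fl v)%:~R * w) by apply/OE; eexists; eexists.
  suff /eqP : (j%:R * z - i%:R * z) - ((fl u' - fl u)%:~R + (fl v' - fl v)%:~R * w) = 0.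
    by rewrite subr_eq0 => /eqP; rewrite natrB ?(ltnW lij) // mulrBl => ->.
  apply: Jbig.
    by case: aJ => _ hBJ; exact: (hBJ _ _ (hBJ _ _ (Jnat j) (Jnat i)) (OJ _ o)).
  rewrite /N (@UVu (u' - u - (fl u' - fl u)%:~R) (v' - v - (fl v' - fl v)%:~R)).
    by apply: small; apply: bxP.
  rewrite e e' -[u%:A]/(ia u) -[v%:A]/(ia v) -[u'%:A]/(ia u') -[v'%:A]/(ia v') !iaE; ring.
have /dvdnP [q ->] : (j - i %| (M * M)`!)%N.
  by rewrite dvdn_fact // subn_gt0 lij /= (leq_trans (leq_subr _ _)) // -ltnS.
by move=> h; rewrite natrM -mulrA; apply: qoM => //; rewrite pmulrn; apply: qoZ.
Qed.

HB.instance Definition _ := gen_eqMixin properIdeal.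
HB.instance Definition _ := gen_choiceMixin properIdeal.

Definition pid_equivb I J := `[< pid_equiv I J >].
Lemma pid_equivb_refl : reflexive pid_equivb.
Proof. by move=> I; apply/asboolP/pid_equiv_refl. Qed.
Lemma pid_equivb_sym : symmetric pid_equivb.
Proof. by move=> I J; apply/asboolP/asboolP; apply: pid_equiv_sym. Qed.
Lemma pid_equivb_trans : transitive pid_equivb.
Proof.
by move=> J I L /asboolP h /asboolP h'; apply/asboolP; apply: pid_equiv_trans h h'.
Qed.
Canonical pid_equiv_rel :=
  EquivRel pid_equivb pid_equivb_refl pid_equivb_sym pid_equivb_trans.

(* Proper fractional ideals modulo principal ideals. The group law is the product
   of representatives, and the inverse of the class of I is that of (O : I). *)
Definition classGroup := {eq_quot pid_equiv_rel}%qT.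
HB.instance Definition _ := Choice.on classGroup.
HB.instance Definition _ := EqQuotient.on classGroup.

Definition idealClass (I : properIdeal) : classGroup := (\pi_classGroup I)%qT.

Lemma idealClassP I J : idealClass I = idealClass J <-> pid_equiv I J.
Proof.
rewrite /idealClass; split; first by move/eqmodP/asboolP.
by move=> h; apply/eqmodP/asboolP.
Qed.

Lemma idealClass_surj (x : classGroup) : exists I, x = idealClass I.
Proof. by exists (repr x); rewrite /idealClass reprK. Qed.

Lemma classGroup_fin : exists (F : finType) (f : classGroup -> F), injective f.
Proof.
case: (qo_struct O) => w [_ [_ [OE _ _ _ _]]].
have [[|L] // _ hL] := class_bound.
have /choice [J hJ] : forall c : classGroup, exists J : properIdeal, [/\ idealClass J = c,
    (forall x, O x -> J x) & (forall x, J x -> O (L.+1%:R * x))].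
  move=> c.
  have [I ->] := idealClass_surj c; have [J /idealClassP e [h1 h2]] := hL I.
  by exists J.
have LK : L.+1%:R != 0 :> K by rewrite -iaR fmorph_eq0 pnatr_eq0.
pose e (p : 'I_L.+1 * 'I_L.+1) : K := ((val p.1)%:R + (val p.2)%:R * w) / L.+1%:R.
exists {set 'I_L.+1 * 'I_L.+1}, (fun c => [set p | `[< J c (e p) >]]%SET) => c c' /setP ecc.
have H a a' : (forall p, (`[< J a (e p) >]) = `[< J a' (e p) >]) -> forall x, J a x -> J a' x.
  move=> h x hx; case: (hJ a) => _ Oa La; case: (hJ a') => _ Oa' _.
  have aa := frac_addsub (pid_fractional (J a)); have aa' := frac_addsub (pid_fractional (J a')).
  have /OE [u [v uv]] := La _ hx.
  have ltm (y : int) : (absz (y %% L.+1)%Z < L.+1)%N.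
    have := @modz_ge0 y L.+1; have := @ltz_pmod y L.+1; lia.
  have mE (y : int) : (absz (y %% L.+1)%Z)%:R = y%:~R - (y %/ L.+1)%Z%:~R * L.+1%:R :> K.
    have yE : y%:~R = (y %/ L.+1)%Z%:~R * L.+1%:R + (y %% L.+1)%Z%:~R :> K.
      by rewrite {1}(divz_eq y L.+1) zD zM.
    by rewrite pmulrn gez0_abs ?modz_ge0 // yE; ring.
  pose p := (Ordinal (ltm u), Ordinal (ltm v)).
  pose o := (u %/ L.+1)%Z%:~R + (v %/ L.+1)%Z%:~R * w.
  have xE : x = e p + o.
    apply: (mulfI LK); rewrite uv mulrDr.
    have -> : L.+1%:R * e p = (val p.1)%:R + (val p.2)%:R * w by rewrite /e mulrC divfK.
    rewrite /o /= !mE.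
    ring.
  have ho : O o by apply/OE; eexists; eexists.
  have : J a (e p).
    by rewrite -(addrK o (e p)) -xE; case: aa => _; apply => //; apply: Oa.
  move/asboolP; rewrite h => /asboolP hp.
  by rewrite xE; apply: addsubD => //; apply: Oa'.
case: (hJ c) => <- _ _; case: (hJ c') => <- _ _; congr idealClass; apply: pid_inj.
apply/funext => x; apply/propext; split; apply: H => p.
  by have := ecc p; rewrite !inE.
by have := ecc p; rewrite !inE.
Qed.

Lemma classGroup_pcan : exists (F : finType) (f : classGroup -> F) (g : F -> option classGroup),
  pcancel f g.
Proof.
case: classGroup_fin => F [f fi]; exists F, f.
exists (fun y => if pselect (exists x, f x = y) is left h then Some (projT1 (cid h)) else None).
move=> x /=; case: pselect => [h|[]]; last by exists x.
by congr Some; apply: fi; case: cid.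
Qed.

Definition classGroup_code : classGroup -> projT1 (cid classGroup_pcan) :=
  projT1 (cid (projT2 (cid classGroup_pcan))).
Lemma classGroup_codeK : pcancel classGroup_code
  (projT1 (cid (projT2 (cid (projT2 (cid classGroup_pcan)))))).
Proof. exact: (projT2 (cid (projT2 (cid (projT2 (cid classGroup_pcan)))))). Qed.

HB.instance Definition _ : isCountable classGroup := PCanIsCountable classGroup_codeK.
HB.instance Definition _ : isFinite classGroup := PCanIsFinite classGroup_codeK.

Definition cl_mul (x y : classGroup) : classGroup :=
  idealClass (pid_mul (repr x) (repr y)).
Definition cl_one : classGroup := idealClass pid_one.
Definition cl_inv (x : classGroup) : classGroup := idealClass (pid_inv (repr x)).

Lemma idealClassM I J : cl_mul (idealClass I) (idealClass J) = idealClass (pid_mul I J).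
Proof.
apply/idealClassP/pid_equiv_mul; apply/idealClassP; exact: reprK.
Qed.

Lemma cl_mulC : commutative cl_mul.
Proof. by move=> x y; apply/idealClassP; rewrite (@pid_inj (pid_mul (repr x) (repr y)) (pid_mul (repr y) (repr x)) (smulC _ _)); apply: pid_equiv_refl. Qed.

Lemma cl_mulA : associative cl_mul.
Proof.
move=> x y z; have [[I ->] [J ->] [L ->]] := And3 (idealClass_surj x) (idealClass_surj y) (idealClass_surj z).
rewrite !idealClassM; congr idealClass; apply: pid_inj.
by apply: smulA; apply: frac_addsub; apply: pid_fractional.
Qed.

Lemma cl_mul1 : left_id cl_one cl_mul.
Proof.
move=> x; have [I ->] := idealClass_surj x; rewrite idealClassM; congr idealClass.
by apply: pid_inj; apply: smulO; apply: pid_fractional.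
Qed.

Lemma cl_mulV : left_inverse cl_one cl_inv cl_mul.
Proof.
move=> x; rewrite -[X in cl_mul _ X]reprK idealClassM.
congr idealClass; apply: pid_inj; rewrite /= smulC.
by apply: proper_inv; [apply: pid_fractional | apply: pid_proper].
Qed.

HB.instance Definition _ := Finite_isGroup.Build classGroup cl_mulA cl_mul1 cl_mulV.

End Class.

Lemma classGroup_abelian (K : imQuadField) (O : quadOrder K) :
  abelian [set: classGroup O].
Proof. by apply/centsP => x _ y _; apply: cl_mulC. Qed.

Section Arithmetic.
Variable K : imQuadField.

Definition ringOfIntegers : set K := integralOver (intr : int -> K).

Definition has_conductor (O : quadOrder K) (f : nat) :=
  forall x : K, O x <->
    exists a : int, exists2 y, ringOfIntegers y & x = a%:~R + f%:R * y.

(* The trace of K over rat, as the trace of the multiplication by x. *)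
Definition fieldTrace (x : K) : rat :=
  \tr (passmx.mxof (vbasis {: K}) (vbasis {: K}) (amull x)).

(* The vectors of the Q-basis w form a Z-basis of the ring of integers. *)
Definition is_discriminant (D : int) :=
  exists w : 2.-tuple K,
    [/\ basis_of {: K} w,
        forall x : K, ringOfIntegers x <->
          exists a : 'I_2 -> int, x = \sum_(i < 2) w`_i *~ a i &
        D%:~R = \det (\matrix_(i < 2, j < 2) fieldTrace (w`_i * w`_j))].

Definition prime_ideal (P : set K) :=
  [/\ forall x, P x -> ringOfIntegers x,
      P 0 /\ forall x y, P x -> P y -> P (x - y),
      forall a x, ringOfIntegers a -> P x -> P (a * x),
      ~ P 1 &
      forall x y, ringOfIntegers x -> ringOfIntegers y -> P (x * y) -> P x \/ P y].

Definition rational_ideal (l : nat) : set K :=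
  fun x => exists2 y, ringOfIntegers y & x = l%:R * y.

Definition split_prime (l : nat) :=
  exists P Q : set K, [/\ prime_ideal P, prime_ideal Q, P <> Q &
    rational_ideal l = smul P Q].

Definition inert_prime (l : nat) := prime_ideal (rational_ideal l).

Definition ramified_prime (l : nat) :=
  exists2 P : set K, prime_ideal P & rational_ideal l = smul P P.

End Arithmetic.

(* 'Ldiv_l(S) is S[l], so that #|S[l]| = l ^ rk l S when S is abelian and l is
   prime; rkE compares rk with the rank of the library and with the number of
   cyclic factors. *)
Definition rk (l : nat) (gT : finGroupType) (S : {group gT}) : nat :=
  logn l #|'Ldiv_l(S)%g|.

Lemma rkE (l : nat) (gT : finGroupType) (S : {group gT}) :
  (l.-group S)%g -> abelian S ->
  rk l S = 'r(S)%g /\ rk l S = size (abelian_type S).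
Proof.
move=> lS cSS; rewrite size_abelian_type //; suff -> : rk l S = 'r(S)%g by [].
by rewrite (rank_pgroup lS) p_rank_abelian // (OhmEabelian lS) ?(abelianS (Ohm_sub 1 S)).
Qed.

Lemma card_Ldiv (l : nat) (gT : finGroupType) (S : {group gT}) :
  prime l -> (l.-group S)%g -> abelian S -> #|'Ldiv_l(S)%g| = (l ^ rk l S)%N.
Proof.
move=> l_pr lS cSS; rewrite /rk; have := OhmEabelian (n := 1) lS.
rewrite (abelianS (Ohm_sub 1 S)) // expn1 => <- //.
by rewrite -p_part part_pnat_id // -/(pgroup _ _) (pgroupS (Ohm_sub 1 S)).
Qed.

(* Main.v *)
Require Import Defs.
From mathcomp Require Import boolp classical_sets.
From mathcomp Require Import all_boot all_order all_fingroup all_algebra.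
From mathcomp Require Import all_solvable all_field.
From mathcomp Require Import ring lra zify.
Set Implicit Arguments.
Unset Strict Implicit.
Unset Printing Implicit Defensive.
Import Order.TTheory GRing.Theory Num.Theory.
Import Defs passmx.

(** Let O' = Z + mR with m = l or m = l^2. If L is an invertible R-ideal and x in L
    satisfies xR + mL = L, then J(L, x) = Zx + mL is an invertible O'-ideal with
    R J(L, x) = L, and J(L, x) J(L', x') = J(LL', xx'). Hence I -> RI induces a
    surjection Cl(O') -> Cl(R), whose kernel consists of the classes of the J(R, x),
    x a unit modulo m. For a surjection f : G -> H of finite abelian groups with
    kernel N one has |G[l]| |N meet lG| = |H[l]| |N|, so the ranks agree when N
    lies in lG, and differ by at most 1 when |N| <= l.

    If R = Z[w] with w^2 = tw - n and l | t, n, then the kernel of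
    Cl(Z + lR) -> Cl(R) is given by the x = 1 + bw, 0 <= b < l. The kernel of
    Cl(Z + l^2 R) -> Cl(Z + lR) consists of l-th powers as soon as
    (1 + w)^l = A + l B w with l not dividing A B, which can only fail for l = 3
    and 9 | 3 + 3t + t^2 - n; the latter occurs precisely for the first step when
    3 is ramified and D = 6 mod 9. If l does not divide t^2 - 4n, then
    x^(l^2) = x modulo lR, so the kernel of Cl(Z + lR) -> Cl(R) again consists of
    l-th powers. *)

(** * Ranks of Sylow subgroups along a surjection of finite abelian groups *)

Section Ranks.
Local Open Scope nat_scope.
Local Open Scope group_scope.

Lemma Ldiv_Sylow (l : nat) (gT : finGroupType) (S : {group gT}) : prime l ->
  abelian [set: gT] -> l.-Sylow([set: gT]) S -> 'Ldiv_l(S) = 'Ldiv_l([set: gT]).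
Proof.
move=> l_pr cGG sylS; apply/setP=> x; rewrite !inE /=.
case: eqP => [xl|]; rewrite ?andbF // andbT.
have nS : S <| [set: gT] by rewrite -sub_abelian_normal ?subsetT.
rewrite (mem_normal_Hall sylS) ?inE // /p_elt.
apply: (@pnat_dvd _ l); first by rewrite order_dvdn xl.
by rewrite pnat_id.
Qed.

Section Kernel.
Variables (l : nat) (G H : finGroupType) (f : {morphism [set: G] >-> H}).
Hypotheses (cG : abelian [set: G]) (cH : abelian [set: H]).

Definition powers (gT : finGroupType) : {set gT} := [set x ^+ l | x : gT].

Lemma card_Ldiv_powers (gT : finGroupType) : abelian [set: gT] ->
  (#|'Ldiv_l([set: gT])| * #|powers gT| = #|gT|)%N.
Proof.
move=> cgT.
have pM : {in [set: gT] &, {morph (fun x : gT => x ^+ l) : x y / x * y}}.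
  by move=> x y hx hy; apply/expgMn/(centsP cgT).
pose p := Morphism pM.
have -> : powers gT = p @* [set: gT].
  by rewrite morphimEdom; apply/setP=> y; apply/imsetP/imsetP => -[x _ ->]; exists x.
have -> : 'Ldiv_l([set: gT]) = 'ker p :> {set gT}.
  by apply/setP=> x; rewrite !inE /=.
by rewrite card_morphim setIid Lagrange ?cardsT // subsetT.
Qed.

Hypothesis f_surj : forall y, exists x, f x = y.

(** [f] maps the l-th powers of [G] onto those of [H], with kernel ['ker f :&: powers G]. This is
    combined with |G| = |H| |ker f| and with the count of kernel and image of the l-th power map on
    each group. *)
Lemma card_Ldiv_ker : (#|'Ldiv_l([set: G])| * #|'ker f :&: powers G| =
  #|'Ldiv_l([set: H])| * #|'ker f|)%N.
Proof.
have pM : {in [set: G] &, {morph (fun x : G => x ^+ l) : x y / x * y}}.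
  by move=> x y hx hy; apply/expgMn/(centsP cG).
pose p := Morphism pM.
have pG : powers G = p @* [set: G].
  by rewrite morphimEdom; apply/setP=> y; apply/imsetP/imsetP => -[x _ ->]; exists x.
have imf : f @* [set: G] = [set: H].
  apply/setP=> y; rewrite inE; have [x <-] := f_surj y; exact: mem_morphim.
have pH : f @* powers G = powers H.
  rewrite morphimE setTI; apply/setP=> y; apply/imsetP/imsetP.
    by case=> _ /imsetP[x _ ->] ->; exists (f x) => //; rewrite morphX ?inE.
  case=> z _ ->; have [x <-] := f_surj z; exists (x ^+ l); last by rewrite morphX ?inE.
  by apply/imsetP; exists x.
have h1 : (#|'ker f| * #|H| = #|G|)%N.
  rewrite -[#|H|]cardsT -imf card_morphim setIid Lagrange ?cardsT //.
  exact: subsetT.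
have h2 : (#|'ker f :&: powers G| * #|powers H| = #|powers G|)%N.
  by rewrite -pH pG card_morphim setTI -indexgI setIC Lagrange // subsetIl.
have h3 := card_Ldiv_powers cG; have h4 := card_Ldiv_powers cH.
have pH0 : 0 < #|powers H| by apply/card_gt0P; exists (1 ^+ l); apply/imsetP; exists 1.
apply/eqP; rewrite -(eqn_pmul2r pH0); apply/eqP.
by rewrite -mulnA h2 h3 -h1 -h4; lia.
Qed.

Variables (S : {group G}) (T : {group H}).
Hypotheses (l_pr : prime l) (sS : l.-Sylow([set: G]) S) (sT : l.-Sylow([set: H]) T).

Let rkS : #|'Ldiv_l([set: G])| = (l ^ rk l S)%N.
Proof.
rewrite -(Ldiv_Sylow l_pr cG sS) card_Ldiv ?(pHall_pgroup sS) //.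
exact: abelianS (subsetT _) cG.
Qed.
Let rkT : #|'Ldiv_l([set: H])| = (l ^ rk l T)%N.
Proof.
rewrite -(Ldiv_Sylow l_pr cH sT) card_Ldiv ?(pHall_pgroup sT) //.
exact: abelianS (subsetT _) cH.
Qed.

Lemma rk_ker_powers : (forall x, f x = 1 -> exists y, x = y ^+ l) -> rk l S = rk l T.
Proof.
move=> kp; have := card_Ldiv_ker; rewrite rkS rkT.
have -> : 'ker f :&: powers G = 'ker f.
  apply/setIidPl/subsetP => x /kerP-/(_ (in_setT x)) /kp[y ->].
  by apply/imsetP; exists y.
move/eqP; rewrite eqn_pmul2r ?cardG_gt0 // eqn_exp2l ?prime_gt1 //.
by move/eqP.
Qed.

(** The kernel meets the powers in at least 1 and at most |ker f| elements, so [card_Ldiv_ker] gives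
    l^rk(T) <= l^rk(S) <= l^(rk(T) + 1). *)
Lemma rk_ker_small : (#|'ker f| <= l)%N -> rk l S = rk l T \/ rk l S = (rk l T + 1)%N.
Proof.
move=> kl; have := card_Ldiv_ker; rewrite rkS rkT.
set k := #|'ker f :&: _|; set K := #|'ker f| => e.
have k0 : (0 < k)%N.
  apply/card_gt0P; exists 1; rewrite inE group1; apply/imsetP; exists 1 => //.
  by rewrite expg1n.
have K0 : (0 < K)%N := cardG_gt0 _.
have kK : (k <= K)%N by apply/subset_leq_card/subsetIl.
have l1 := prime_gt1 l_pr.
have : (rk l T <= rk l S)%N.
  rewrite -(leq_exp2l _ _ l1) -(leq_pmul2r K0) -e leq_mul2l kK orbT //.
have : (rk l S <= (rk l T).+1)%N.
  rewrite -(leq_exp2l _ _ l1) expnS mulnC.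
  apply: (@leq_trans (l ^ rk l S * k)); first by rewrite leq_pmulr.
  by rewrite e leq_mul2l kl orbT.
by lia.
Qed.

End Kernel.
End Ranks.

Local Open Scope ring_scope.

(** * Orders Z[w], their residue maps in characteristic l, and units modulo powers of l *)

Section Generator.
Variables (K : imQuadField) (R : quadOrder K).

Definition qo_gen (w : K) (t n : int) :=
  [/\ forall x, R x <-> exists a b : int, x = a%:~R + b%:~R * w,
      w ^+ 2 = t%:~R * w - n%:~R &
      forall a b a' b' : int, a%:~R + b%:~R * w = a'%:~R + b'%:~R * w ->
        a = a' /\ b = b'].

Lemma qo_gen_exists : exists w t n, qo_gen w t n.
Proof.
case: (qo_struct R) => w [t [n [RE w2 _ _ inj]]]; exists w, t, n; split=> //.
move=> a b a' b' e; case: (inj a%:~R b%:~R a'%:~R b'%:~R); first by rewrite !iaZ.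
by move=> /intr_inj -> /intr_inj ->.
Qed.

Definition unitmod (m : nat) (x : K) :=
  exists2 z, R z & exists2 r, R r & x * z = 1 + m%:R * r.

(** A ring morphism on [R]; [f] is total on [K] and its values outside [R] are arbitrary. *)
Definition residue_map (F : fieldType) (f : K -> F) :=
  [/\ forall x y, R x -> R y -> f (x + y) = f x + f y,
      forall x y, R x -> R y -> f (x * y) = f x * f y &
      forall k : int, f k%:~R = k%:~R].

Variables (w : K) (t n : int) (l : nat).
Hypotheses (l_pr : prime l) (gw : qo_gen w t n).

Lemma gen_mem (a b : int) : R (a%:~R + b%:~R * w).
Proof. by case: gw => RE _ _; apply/RE; exists a, b. Qed.

(** The roots r and t - r of X^2 - tX + n in an algebraic closure of F_l define the evaluations of w
    at r and at t - r. *)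
Lemma residue_maps : exists (F : fieldType) (f g : K -> F),
  [/\ l \in [pchar F], residue_map f, residue_map g,
      f w + g w = t%:~R & f w * g w = n%:~R].
Proof.
case: gw => RE w2 inj.
have [F [i _]] := countable_algebraic_closure 'F_l.
have lF : l \in [pchar F] by rewrite (fmorph_pchar i) pchar_Fp.
pose p : {poly F} := 'X^2 - t%:~R *: 'X + n%:~R%:P.
have sp : size p != 1%N.
  rewrite /p -addrA size_polyDl ?size_polyXn //.
  apply: (leq_ltn_trans (size_polyD _ _)); rewrite gtn_max.
  rewrite size_polyN (leq_ltn_trans (size_scale_leq _ _)) ?size_polyX //.
  by rewrite (leq_ltn_trans (size_polyC_leq1 _)).
have /closed_rootP [r] := sp; rewrite rootE !hornerE => /eqP r0.
(* Integer coordinates in the basis (1, w); the pair (0, 0) is a default outside [R]. *)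
have /choice [co coP] : forall x : K, exists q : int * int,
    R x -> x = q.1%:~R + q.2%:~R * w.
  move=> x; case: (pselect (R x)) => [/RE [a [b e]]|nx]; last by exists (0, 0).
  by exists (a, b).
have coE (a b : int) : co (a%:~R + b%:~R * w) = (a, b).
  have := coP _ (gen_mem a b); case: (co _) => a' b' /= /inj [-> ->] //.
pose ev (s : F) x : F := (co x).1%:~R + (co x).2%:~R * s.
have evP s : s ^+ 2 = t%:~R * s - n%:~R -> residue_map (ev s) /\ ev s w = s.
  move=> s2; split; first split.
  - move=> x y /RE [a [b ->]] /RE [a' [b' ->]].
    have -> : a%:~R + b%:~R * w + (a'%:~R + b'%:~R * w) =
      (a + a')%:~R + (b + b')%:~R * w by rewrite !zE; ring.
    rewrite /ev !coE /= !zE; ring.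
  - move=> x y /RE [a [b ->]] /RE [a' [b' ->]].
    have -> : (a%:~R + b%:~R * w) * (a'%:~R + b'%:~R * w) =
      (a * a' - b * b' * n)%:~R + (a * b' + b * a' + b * b' * t)%:~R * w.
      rewrite !zE; have -> : n%:~R = t%:~R * w - w ^+ 2 by rewrite w2; ring.
      ring.
    rewrite /ev !coE /= !zE.
    have -> : n%:~R = t%:~R * s - s ^+ 2 by rewrite s2; ring.
    ring.
  - move=> k; have {1}-> : k%:~R = k%:~R + (0 : int)%:~R * w by rewrite mul0r addr0.
    by rewrite /ev coE /= mul0r addr0.
  have -> : w = (0 : int)%:~R + (1 : int)%:~R * w by rewrite mul1r add0r.
  by rewrite /ev coE /= add0r mul1r.
have r2 : r ^+ 2 = t%:~R * r - n%:~R.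
  by apply/eqP; rewrite -subr_eq0 -r0; apply/eqP; ring.
have nE : n%:~R = t%:~R * r - r ^+ 2 by rewrite r2; ring.
have [h1 e1] := evP r r2.
have [|h2 e2] := evP (t%:~R - r); first by rewrite nE; ring.
exists F, (ev r), (ev (t%:~R - r)); split=> //; first by rewrite e1 e2; ring.
by rewrite e1 e2 nE; ring.
Qed.

(** [z] is the conjugate of [x] and [k] its norm; as [f] and [g] send w to the two roots, the norm
    reduces to f(x) g(x). *)
Lemma gen_norm (F : fieldType) (f g : K -> F) x : residue_map f -> residue_map g ->
  f w + g w = t%:~R -> f w * g w = n%:~R -> R x ->
  exists2 z, R z & exists2 k : int, x * z = k%:~R & k%:~R = f x * g x.
Proof.
case: gw => RE w2 inj [fD fM fZ] [gD gM gZ] et en /RE [a [b ->]].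
exists ((a + b * t)%:~R + (- b)%:~R * w); first exact: gen_mem.
have Rw : R w by have := gen_mem 0 1; rewrite mul1r add0r.
have RZ := qoZ R; have Rbw : R (b%:~R * w) by apply: qoM.
exists (a ^+ 2 + t * a * b + n * b ^+ 2).
  rewrite !zE; have -> : n%:~R = t%:~R * w - w ^+ 2 by rewrite w2; ring.
  ring.
rewrite fD // gD // fM // gM // !fZ !gZ !zE -et -en; ring.
Qed.

Lemma int_pchar (F : fieldType) (k : int) : l \in [pchar F] ->
  (k%:~R == 0 :> F) = (l %| k)%Z.
Proof.
move=> lF; case: k => k.
  by rewrite -[_%:~R]/(k%:R) -(dvdn_pcharf lF) dvdzE.
by rewrite NegzE zN oppr_eq0 -[_%:~R]/(k.+1%:R) -(dvdn_pcharf lF) dvdzE.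
Qed.

Lemma coprimez_inv (j : nat) (k : int) : ~~ (l %| k)%Z ->
  exists u v : int, k * u = 1 + (l ^ j)%N%:Z * v.
Proof.
move=> nk; have /coprimezP [[u v] /= e] : coprimez k (l ^ j)%N.
  rewrite /coprimez /gcdz /= gcdnC -[_ == 1]/(coprime _ _) coprimeXl //.
  by rewrite prime_coprime.
by exists u, (- v); rewrite -e; ring.
Qed.

(** An inverse u of [k] modulo l^j turns the cofactor [z] into an inverse zu of [x]. *)
Lemma unitmod_int (j : nat) (x z : K) (k : int) : R z -> x * z = k%:~R ->
  ~~ (l %| k)%Z -> unitmod (l ^ j) x.
Proof.
move=> Rz xz /(coprimez_inv j) [u [v e]]; exists (z * u%:~R); first exact/qoM/qoZ.
by exists v%:~R; [exact: qoZ | rewrite mulrA xz -zM e zD zM].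
Qed.

(* Two residue maps of R into a field containing the roots of X^2 - tX + n detect
   the units modulo l; x is chosen among a, a', a + a' to avoid both kernels. *)
Lemma good_pair (I : properIdeal R) (j : nat) : exists x y,
  [/\ I x, colon R I y & unitmod (l ^ j) (x * y)].
Proof.
have [F [f [g [lF hf hg et en]]]] := residue_maps.
have fI := pid_fractional I; have aI := frac_addsub fI.
have fC := colon_frac fI; have aC := frac_addsub fC.
have IC x y : I x -> colon R I y -> R (x * y) by move=> hx hy; rewrite mulrC; apply: hy.
have F1 : exists x y, [/\ I x, colon R I y & f (x * y) != 0] /\
    exists x y, [/\ I x, colon R I y & g (x * y) != 0].
  (* Otherwise [h] would vanish on the sums of such products, which include 1 because a proper ideal
     is invertible, while h(1) = 1. *)
  have H h : residue_map h -> exists x y, [/\ I x, colon R I y & h (x * y) != 0 :> F].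
    case=> hD hM hZ; apply: contrapT => nex.
    have h0 x y : I x -> colon R I y -> h (x * y) = 0.
      by move=> hx hy; apply/eqP/negPn/negP => h0; apply: nex; exists x, y.
    have : R 1 /\ h 1 = 0.
      have : smul I (colon R I) 1.
        by rewrite (proper_inv fI (pid_proper I)); apply: qo1.
      case=> s hs ->; rewrite big_seq.
      apply: (big_ind (fun z : K => R z /\ h z = 0)).
      - by split; [exact: qo0 | have := hZ 0].
      - by move=> x y [Rx ex] [Ry ey]; split; [exact: qoD | rewrite hD // ex ey addr0].
      - by move=> p /hs [h1 h2]; split; [exact: IC | exact: h0].
    by case=> _; have := hZ 1 => -> /eqP; rewrite oner_eq0.
  by have [x [y hx]] := H f hf; exists x, y; split=> //; apply: H.
case: F1 => a [b [[ha hb hab] [a' [b' [ha' hb' hab']]]]].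
have [fD fM fZ] := hf; have [gD gM gZ] := hg.
have [x hx [xb xb']] : exists2 x, I x & f (x * b) != 0 /\ g (x * b') != 0.
  have [e1|] := eqVneq (g (a * b')) 0; last by exists a.
  have [e2|] := eqVneq (f (a' * b)) 0; last by exists a'.
  exists (a + a'); first exact: addsubD.
  by rewrite !mulrDl fD ?gD ?e1 ?e2 ?addr0 ?add0r //; apply: IC.
have [y hy [ya ya']] : exists2 y, colon R I y & f (a * y) != 0 /\ g (a' * y) != 0.
  have [e1|] := eqVneq (g (a' * b)) 0; last by exists b.
  have [e2|] := eqVneq (f (a * b')) 0; last by exists b'.
  exists (b + b'); first exact: (addsubD aC).
  by rewrite !mulrDr fD ?gD ?e1 ?e2 ?addr0 ?add0r //; apply: IC.
exists x, y; split=> //.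
have Rxy : R (x * y) by apply: IC.
(* Here (xy)(ab) = (xb)(ay), and [f] is nonzero on both factors on the right. *)
have fxy : f (x * y) != 0.
  suff : f (x * y) * f (a * b) != 0 by rewrite mulf_eq0 negb_or => /andP[].
  rewrite -fM //; last exact: IC.
  by rewrite mulrACA [y * b]mulrC mulrACA fM ?mulf_neq0 //; apply: IC.
have gxy : g (x * y) != 0.
  suff : g (x * y) * g (a' * b') != 0 by rewrite mulf_eq0 negb_or => /andP[].
  rewrite -gM //; last exact: IC.
  by rewrite mulrACA [y * b']mulrC mulrACA gM ?mulf_neq0 //; apply: IC.
have [z Rz [k e ek]] := gen_norm hf hg et en Rxy.
apply: (@unitmod_int j _ _ _ Rz e).
by rewrite -(int_pchar k lF) ek mulf_neq0.
Qed.

End Generator.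

(** * The ideals Zx + mL and the extension map between class groups *)

Section Conductor.
Variables (K : imQuadField) (R O' : quadOrder K) (l j : nat).
Hypothesis l_pr : prime l.
Let m : nat := (l ^ j)%N.

Definition suborder := forall x : K, O' x <->
  exists a : int, exists2 y, R y & x = a%:~R + (l ^ j)%N%:R * y.
Hypothesis hO : suborder.

Lemma suborderW x : O' x -> R x.
Proof. by move=> /hO [a [y hy ->]]; apply: qoD; [exact: qoZ | apply: qoM; [exact: (qoZ R m) | ]]. Qed.

Lemma suborder_scaled x : R x -> O' (m%:R * x).
Proof. by move=> hx; apply/hO; exists 0, x; rewrite ?add0r. Qed.

Lemma expn_neq0 : m%:R != 0 :> K.
Proof. by rewrite -iaR fmorph_eq0 pnatr_eq0 -lt0n expn_gt0 prime_gt0. Qed.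

Lemma qo_nat (k : nat) : R k%:R. Proof. exact: (qoZ R k). Qed.

Definition Jset (L : set K) (x : K) : set K :=
  fun z => exists a : int, exists2 y, L y & z = a%:~R * x + m%:R * y.

(* For an invertible ideal L this says that xR + mL = L. *)
Definition good (L : set K) (x : K) :=
  L x /\ exists2 y, colon R L y & unitmod R m (x * y).

(** Multiply the relation xyz = 1 + mr by [u]: the element uyz lies in [R] because [y] multiplies
    [L] into [R]. *)
Lemma good_decomp L x u : good L x -> L u ->
  exists r s, [/\ R r, R s & u = x * r + m%:R * (s * u)].
Proof.
case=> _ [y hy [z Rz [r Rr e]]] Lu; exists (u * y * z), (- r).
split; [by apply: qoM => //; rewrite mulrC; apply: hy | exact: qoN|].
have -> : x * (u * y * z) = u * (x * y * z) by ring.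
by rewrite e; ring.
Qed.

Lemma good_unitmod x : R x -> unitmod R m x -> good R x.
Proof. by move=> hx ux; split=> //; exists 1; rewrite ?mulr1 // => y; rewrite mul1r. Qed.

Lemma mem_Jset L x : L 0 -> Jset L x x.
Proof. by move=> L0; exists 1, 0; rewrite // mul1r mulr0 addr0. Qed.

Lemma mem_Jset_scaled L x y : L y -> Jset L x (m%:R * y).
Proof. by move=> Ly; exists 0, y; rewrite // mul0r add0r. Qed.

Lemma Jset_addsub L x : addsub L -> addsub (Jset L x).
Proof.
case=> L0 LB; split; first by exists 0, 0; rewrite // mul0r mulr0 addr0.
move=> y z [a [u hu ->]] [b [v hv ->]]; exists (a - b), (u - v); first exact: LB.
by rewrite zB; ring.
Qed.

Lemma fractional_mulz L (k : int) x : fractional R L -> L x -> L (k%:~R * x).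
Proof. by case=> _ _ h _ hx; apply: h => //; apply: qoZ. Qed.

(** The inclusion from left to right is an expansion. Conversely, for u in L and v in L',
    [good_decomp] writes muv as x (mrv) + (msu)(mv), a sum of two products. *)
Lemma smul_Jset L L' x x' : fractional R L -> fractional R L' -> good L x -> L' x' ->
  smul (Jset L x) (Jset L' x') = Jset (smul L L') (x * x').
Proof.
move=> fL fL' gx hx'; have hx := gx.1.
have aL := frac_addsub fL; have aL' := frac_addsub fL'.
have fLL := frac_smul fL fL'; have aLL := frac_addsub fLL.
have aJ := smul_addsub (Jset L' x') (Jset_addsub x aL).
have Rm : R m%:R := qo_nat m.
have [_ _ LM _] := fL; have [_ _ LM' _] := fL'.
apply/funext => z; apply/propext; split.
  move: z; apply: smul_ind; first exact: Jset_addsub.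
  move=> _ _ [a [u hu ->]] [b [v hv ->]].
  exists (a * b), (a%:~R * (x * v) + (b%:~R * (u * x') + m%:R * (u * v))).
    by do ?[apply: addsubD => //]; do ?[apply: fractional_mulz => //];
       rewrite ?[m%:R]pmulrn; do ?[apply: fractional_mulz => //]; apply: smul_mem.
  by rewrite zM; ring.
case=> a [y hy ->]; apply: addsubD => //.
  by rewrite mulrA; apply: smul_mem; [exists a, 0; [case: aL|rewrite mulr0 addr0] | apply: mem_Jset; case: aL'].
rewrite mulrC; move: y hy; apply: smul_ind; first exact: addsub_mulr.
move=> u v hu hv; have [r [s [Rr Rs e]]] := good_decomp gx hu.
have -> : u * v * m%:R = x * (m%:R * (r * v)) + (m%:R * (s * u)) * (m%:R * v).
  by rewrite {1}e; ring.
apply: addsubD => //; apply: smul_mem; first by apply: mem_Jset; case: aL.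
- exact/mem_Jset_scaled/LM'.
- exact/mem_Jset_scaled/LM.
- exact: mem_Jset_scaled.
Qed.

Lemma eq_Jset (L : set K) x x' (a b : int) (y y' : K) : addsub L ->
  (forall (k : int) z, L z -> L (k%:~R * z)) -> L y -> L y' ->
  x' = a%:~R * x + m%:R * y -> x = b%:~R * x' + m%:R * y' -> Jset L x = Jset L x'.
Proof.
move=> aL LZ hy hy' e e'.
have H c c' d v (z : K) : L v -> c = d%:~R * c' + m%:R * v -> Jset L c z -> Jset L c' z.
  move=> hv ec [k [u hu ->]]; exists (k * d), (k%:~R * v + u).
    by apply: addsubD => //; apply: LZ.
  by rewrite ec zM; ring.
by apply/funext => z; apply/propext; split; [apply: (H _ _ b y') | apply: (H _ _ a y)].
Qed.

Lemma Jset_one : Jset R 1 = O'.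
Proof.
apply/funext => z; apply/propext; split.
  by case=> a [y hy ->]; apply/hO; exists a, y; rewrite ?mulr1.
by move=> /hO [a [y hy ->]]; exists a, y; rewrite ?mulr1.
Qed.

Lemma Jset_frac L x : fractional R L -> L x -> fractional O' (Jset L x).
Proof.
move=> fL hx; have aL := frac_addsub fL.
have [[u hu nu] LB LM [d nd hd]] := fL; split.
- by exists (m%:R * u); [exact: mem_Jset_scaled | rewrite mulf_neq0 ?expn_neq0].
- by case: (Jset_addsub x aL).
- move=> z _ /hO [a [y hy ->]] [b [v hv ->]].
  exists (a * b), (a%:~R * v + (b%:~R * (y * x) + y * (m%:R * v))).
    apply: addsubD => //; first exact: fractional_mulz.
    apply: addsubD => //; first by apply: fractional_mulz => //; apply: (LM _ _).
    by apply: (LM _ _ hy); apply: (LM _ _ _ hv); apply: qo_nat.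
  by rewrite zM; ring.
- exists (m%:R * d); first by rewrite mulf_neq0 ?expn_neq0.
  move=> _ [b [v hv ->]]; rewrite -mulrA; apply: suborder_scaled; apply: hd.
  by apply: addsubD => //; [exact: fractional_mulz | apply: (LM _ _) => //; apply: qo_nat].
Qed.

(** Properness follows from an explicit inverse: with xyz = 1 modulo mR, the product J(L, x) J(L^-1,
    y) J(R, z) is J(R, xyz) = J(R, 1) = O'. *)
Lemma Jset_ideal (L : properIdeal R) x : good L x ->
  exists I : properIdeal O', (I : set K) = Jset L x.
Proof.
move=> gx; have [hx [y hy uxy]] := gx.
have fL := pid_fractional L; have fC := colon_frac fL.
have fJ := Jset_frac fL hx; have RO := qo_frac R.
have [z Rz [r Rr e]] := uxy.
have Rxy : R (x * y) by rewrite mulrC; apply: hy.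
have gR : good R (x * y) by apply: good_unitmod.
suff pJ : proper_ideal O' (Jset L x) by exists (ProperIdeal fJ pJ).
apply: (@invertible_proper _ _ _ (smul (Jset (colon R L) y) (Jset R z))) => //.
  exact/smul_addsub/Jset_addsub/(frac_addsub fC).
have [aL aC aR] := And3 (frac_addsub fL) (frac_addsub fC) (frac_addsub RO).
rewrite smulA; try exact: Jset_addsub.
rewrite smul_Jset // (proper_inv fL (pid_proper L)) (smul_Jset RO RO gR Rz) smulO // -Jset_one.
apply: (@eq_Jset _ _ _ 1 1 (- r) r); rewrite ?mul1r ?e //.
- by move=> k u hu; apply: qoM => //; apply: qoZ.
- exact: qoN.
- by ring.
Qed.

Lemma smul_suborder : smul R O' = R.
Proof.
apply/funext => z; apply/propext; split.
  apply: smul_ind; first exact: qo_addsub.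
  by move=> a b ha hb; apply: qoM => //; apply: suborderW.
by move=> hz; rewrite -[z]mulr1; apply: smul_mem => //; apply: qo1.
Qed.

Lemma smul_R_Jset (L : properIdeal R) x : good L x -> smul R (Jset L x) = L.
Proof.
move=> gx; have hx := gx.1.
have fL := pid_fractional L; have aL := frac_addsub fL; have [_ _ LM _] := fL.
apply/funext => z; apply/propext; split.
  apply: smul_ind => // a _ ha [b [y hy ->]]; apply: (LM) => //.
  by apply: addsubD => //; [exact: fractional_mulz | apply: (LM _ _) => //; apply: qo_nat].
move=> hz; have [r [s [Rr Rs e]]] := good_decomp gx hz.
rewrite e; apply: addsubD; first exact/smul_addsub/qo_addsub.
  by rewrite mulrC; apply: smul_mem => //; apply: mem_Jset; case: aL.
by rewrite mulrCA; apply: smul_mem => //; apply: mem_Jset_scaled.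
Qed.

Lemma ext_mul (I I' : set K) : addsub I -> addsub I' ->
  smul (smul R I) (smul R I') = smul R (smul I I').
Proof.
move=> aI aI'; have aR := qo_addsub R.
rewrite -smulA ?[smul I (smul R I')]smulA //; try exact: smul_addsub.
rewrite [smul I R]smulC -smulA // smulA //; last exact: smul_addsub.
by rewrite smulO //; apply: qo_frac.
Qed.

Lemma ext_frac (I : properIdeal O') : fractional R (smul R I).
Proof.
have fI := pid_fractional I; have aI := frac_addsub fI.
have [[x hx nx] IB IM [d nd hd]] := fI; have aS := smul_addsub I (qo_addsub R).
split.
- by exists x => //; rewrite -[x]mul1r; apply: smul_mem => //; apply: qo1.
- by case: aS.
- move=> a z ha hz; rewrite mulrC; move: z hz; apply: smul_ind; first exact: addsub_mulr.
  move=> r u hr hu; rewrite mulrC mulrA; apply: smul_mem => //; exact: qoM.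
- exists d => // z hz; rewrite mulrC; move: z hz.
  apply: smul_ind; first exact/addsub_mulr/qo_addsub.
  move=> r u hr hu; rewrite -mulrA; apply: qoM => //; rewrite mulrC.
  exact/suborderW/hd.
Qed.

(** The extension of the inverse of [I] is an inverse of the extension. *)
Lemma ext_proper (I : properIdeal O') : proper_ideal R (smul R I).
Proof.
have fI := pid_fractional I; have aI := frac_addsub fI.
have aC := frac_addsub (colon_frac fI).
apply: (@invertible_proper _ _ _ (smul R (colon O' I))); first exact: ext_frac.
  exact/smul_addsub/qo_addsub.
by rewrite ext_mul // (proper_inv fI (pid_proper I)) smul_suborder.
Qed.

Definition ext (I : properIdeal O') := ProperIdeal (ext_frac I) (ext_proper I).

Lemma ext_equiv I I' : pid_equiv I I' -> pid_equiv (ext I) (ext I').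
Proof.
move=> /pid_equivP [a a0 h]; apply/pid_equivP; exists a => //= x.
have S1 := smul_addsub I (qo_addsub R); have S2 := smul_addsub I' (qo_addsub R).
split=> [hx|].
  suff : smul R I (a * x * a^-1) by rewrite mulrC mulKf.
  move: (a * x) hx; apply: smul_ind; first exact: addsub_mulr.
  move=> r u hr hu; rewrite -mulrA; apply: smul_mem => //.
  by apply/h; rewrite mulrC divfK.
rewrite mulrC; move: x; apply: smul_ind; first exact: addsub_mulr.
by move=> r u hr hu; rewrite -mulrA [u * a]mulrC; apply: smul_mem => //; apply/h.
Qed.

Definition class_ext (c : classGroup O') : classGroup R := idealClass (ext (generic_quotient.repr c)).

Lemma class_extE I : class_ext (idealClass I) = idealClass (ext I).
Proof. by apply/idealClassP/ext_equiv/idealClassP; rewrite /idealClass reprK. Qed.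

Lemma class_extM : {morph class_ext : c d / (c * d)%g}.
Proof.
move=> c d; have [I ->] := idealClass_surj c; have [J ->] := idealClass_surj d.
have -> : (idealClass I * idealClass J)%g = idealClass (pid_mul I J) := idealClassM I J.
rewrite !class_extE [RHS]idealClassM.
congr idealClass; apply: pid_inj => /=; rewrite ext_mul //; exact: frac_addsub (pid_fractional _).
Qed.

Lemma class_ext_surj d : exists c, class_ext c = d.
Proof.
have [L ->] := idealClass_surj d; have [w [t [n gw]]] := qo_gen_exists R.
have [x [y [hx hy u]]] := good_pair l_pr gw L j.
have gx : good L x by split=> //; exists y.
have [I eI] := Jset_ideal gx; exists (idealClass I); rewrite class_extE.
by congr idealClass; apply: pid_inj; rewrite /= eI; apply: smul_R_Jset.
Qed.

(** Here aRI = R for some a, and the ideal aI, which has the same class as I, extends to [R]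
    itself. *)
Lemma class_ext_ker c : class_ext c = 1%g ->
  exists2 I : properIdeal O', c = idealClass I & smul R I = R.
Proof.
have [I ->] := idealClass_surj c; rewrite class_extE => /idealClassP /pid_equivP [a a0 h].
have a0' : a^-1 != 0 by rewrite invr_eq0.
have fJ := frac_scale a0' (pid_fractional I); have pJ := proper_scale a0' (pid_proper I).
have e : pid_equiv I (ProperIdeal fJ pJ).
  by apply/pid_equivP; exists a => //= x; rewrite mulKf.
exists (ProperIdeal fJ pJ); first exact/idealClassP.
suff -> : smul R (fun x => I (a^-1 * x)) = fun x => smul R I (a^-1 * x).
  apply/funext => x; apply/propext; rewrite -{2}(mulVKf a0 x).
  exact: (iff_sym (h (a^-1 * x))).
have aE := smul_addsub I (qo_addsub R).
have aS := smul_addsub (fun x => I (a^-1 * x)) (qo_addsub R).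
apply/funext => z; apply/propext; split.
  rewrite mulrC; move: z; apply: smul_ind; first exact: addsub_mulr.
  by move=> r u hr hu; rewrite -mulrA [u * _]mulrC; apply: smul_mem.
move=> hz; rewrite -(mulVKf a0 z) mulrC; move: (a^-1 * z) hz.
apply: smul_ind; first exact: addsub_mulr.
by move=> r u hr hu; rewrite -mulrA; apply: smul_mem; rewrite //= [u * a]mulrC mulKf.
Qed.

(** Take x, y, z with xyz = 1 + mr over O' from [good_pair]. For u in I, yuz lies in O' = Z + mR,
    and u = x (yuz) - mru puts u in Zx + mR. Conversely mR = (mR) I lies in I, since O' contains
    mR. *)
Lemma ext_trivial (I : properIdeal O') : smul R I = R ->
  exists x, [/\ I x, R x, unitmod R m x & (I : set K) = Jset R x].
Proof.
move=> RI; have [w [t [n gw]]] := qo_gen_exists O'.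
have [x [y [hx hy [z Oz [r Or e]]]]] := good_pair l_pr gw I j.
have IR u : I u -> R u.
  by move=> hu; rewrite -[R u]/((R : set K) u) -RI -[u]mul1r; apply: smul_mem => //; apply: qo1.
have fI := pid_fractional I; have aI := frac_addsub fI; have [_ _ IM _] := fI.
have RW := suborderW.
have Ry : R y.
  suff : R (1 * y) by rewrite mul1r.
  have : smul R I 1 by rewrite RI; apply: qo1.
  move: 1; apply: smul_ind; first exact/addsub_mulr/qo_addsub.
  by move=> s u hs hu; rewrite -mulrA [u * y]mulrC; apply: qoM => //; apply/RW/hy.
exists x; split=> //; first exact: IR.
  by exists (y * z); [apply: qoM => //; apply: RW | exists r; [exact: RW | rewrite mulrA]].
apply/funext => u; apply/propext; split.
  move=> hu; have /hO [a [s Rs es]] : O' (y * u * z) by apply: qoM => //; apply: hy.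
  exists a, (x * s - r * u).
    by apply: qoB; apply: qoM => //; [exact: IR|exact: RW|exact: IR].
  have eu : x * (y * u * z) - m%:R * r * u = u.
    have -> : x * (y * u * z) = (x * y * z) * u by ring.
    by rewrite e; ring.
  by rewrite -{1}eu es -/m; ring.
case=> a [s Rs ->]; apply: addsubD => //; first exact: addsubZ.
have : smul R I s by rewrite RI.
rewrite mulrC; move: s {Rs}; apply: smul_ind; first exact: addsub_mulr.
by move=> s v hs hv; rewrite mulrC mulrA; apply: (IM _ _) => //; apply: suborder_scaled.
Qed.

(* A relation rather than a function of x: J(R, x) is a proper ideal of O' only
   when x is a unit modulo l^j. *)
Definition unit_class (x : K) (c : classGroup O') :=
  [/\ R x, unitmod R m x & exists2 I : properIdeal O', (I : set K) = Jset R x & c = idealClass I].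

Lemma unit_class_exists x : R x -> unitmod R m x -> exists c, unit_class x c.
Proof.
move=> Rx ux; have [I eI] := @Jset_ideal (pid_one R) x (good_unitmod Rx ux).
by exists (idealClass I); split=> //; exists I.
Qed.

Lemma unit_class_inj x x' c c' : unit_class x c -> unit_class x' c' ->
  Jset R x = Jset R x' -> c = c'.
Proof.
move=> [_ _ [I eI ->]] [_ _ [I' eI' ->]] e.
by congr idealClass; apply: pid_inj; rewrite eI eI'.
Qed.

Lemma unitmodM x x' : R x -> R x' -> unitmod R m x -> unitmod R m x' -> unitmod R m (x * x').
Proof.
move=> Rx Rx' [z Rz [r Rr e]] [z' Rz' [r' Rr' e']]; exists (z * z'); first exact: qoM.
exists (r + r' + m%:R * (r * r')).
  by do ?[apply: qoD => //]; do ?[apply: qoM => //]; apply: qo_nat.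
by rewrite mulrACA e e'; ring.
Qed.

Lemma unit_classM x x' c c' : unit_class x c -> unit_class x' c' ->
  unit_class (x * x') (c * c')%g.
Proof.
move=> [Rx ux [I eI ->]] [Rx' ux' [I' eI' ->]]; split; [exact: qoM|exact: unitmodM|].
exists (pid_mul I I'); last exact: idealClassM.
have RO := qo_frac R.
by rewrite /= eI eI' (smul_Jset RO RO (good_unitmod Rx ux) Rx') smulO.
Qed.

Lemma unit_class1 : unit_class 1 1%g.
Proof.
split; first exact: qo1.
  exists 1; first exact: qo1.
  by exists 0; [exact: qo0 | rewrite mulr0 addr0 mulr1].
by exists (pid_one O'); rewrite ?Jset_one.
Qed.

Lemma unit_classX x c k : unit_class x c -> unit_class (x ^+ k) (c ^+ k)%g.
Proof.
move=> h; elim: k => [|k ih]; first exact: unit_class1.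
by rewrite exprS expgS; apply: unit_classM.
Qed.

(** The class is unchanged when [x] is altered by an element of mR or by an integer factor prime to
    m: the kernel is a quotient of (R/mR)^* / (Z/mZ)^*. *)
Lemma eq_unit_class x x' c (a b : int) y y' : R x' -> unit_class x c -> R y -> R y' ->
  x' = a%:~R * x + m%:R * y -> x = b%:~R * x' + m%:R * y' -> unit_class x' c.
Proof.
move=> Rx' [Rx [z Rz [r Rr ez]] [I eI ec]] hy hy' e e'; split=> //.
  exists (b%:~R * z); first exact/qoM/Rz/qoZ.
  exists (r - y' * z); first exact/qoB/qoM.
  by rewrite mulrCA mulrA -[b%:~R * x'](addrK (m%:R * y')) -e' mulrBl ez; ring.
exists I => //; rewrite eI.
apply: (eq_Jset (qo_addsub R) _ hy hy' e e').
by move=> k v hv; apply: qoM => //; apply: qoZ.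
Qed.

Lemma class_ext_ker_unit c : class_ext c = 1%g -> exists x, unit_class x c.
Proof.
case/class_ext_ker => I ec /ext_trivial [x [_ Rx ux eI]].
by exists x; split=> //; exists I.
Qed.

Definition class_ext_morphism :=
  Morphism (D := [set: classGroup O']%g) (fun c d _ _ => class_extM c d).

End Conductor.

(** * Kernels of the extension maps in terms of a generator w *)

Section Generated.
Variables (K : imQuadField) (R : quadOrder K) (w : K) (t n : int) (l : nat).
Hypotheses (l_pr : prime l) (gw : qo_gen R w t n).

Lemma gen_mem_mul (b : int) : R (b%:~R * w).
Proof. by have := gen_mem gw 0 b; rewrite add0r. Qed.

Lemma gen_norm_eq (a b : int) : (a%:~R + b%:~R * w) * ((a + b * t)%:~R + (- b)%:~R * w) =
  (a ^+ 2 + t * a * b + n * b ^+ 2)%:~R.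
Proof.
case: gw => _ w2 _; rewrite !zE.
have -> : n%:~R = t%:~R * w - w ^+ 2 by rewrite w2; ring.
by ring.
Qed.

(** If l divided both [a] and [n], the constant coordinate of any multiple of a + bw would vanish
    modulo l, whereas it has to be 1 modulo l^j for some multiple. *)
Lemma unitmod_coef (j : nat) (a b : int) : (0 < j)%N -> (l %| n)%Z ->
  unitmod R (l ^ j)%N (a%:~R + b%:~R * w) -> ~~ (l %| a)%Z.
Proof.
case: gw => RE w2 inj j0 ln [_ /RE [a' [b' ->]] [_ /RE [c [d ->]] e]].
have : (a * a' - b * b' * n)%:~R + (a * b' + b * a' + b * b' * t)%:~R * w =
    (1 + (l ^ j)%N%:Z * c)%:~R + ((l ^ j)%N%:Z * d)%:~R * w.
  transitivity ((a%:~R + b%:~R * w) * (a'%:~R + b'%:~R * w)).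
    rewrite !zE; have -> : n%:~R = t%:~R * w - w ^+ 2 by rewrite w2; ring.
    by ring.
  by rewrite e !zE /=; ring.
case/inj => e1 _; apply/negP => la.
have : (l %| a * a' - b * b' * n - (l ^ j)%N%:Z * c)%Z.
  apply: rpredB; first by apply: rpredB; [exact: dvdz_mulr | exact: dvdz_mull].
  by apply: dvdz_mulr; rewrite dvdzE /=; apply: dvdn_exp.
by rewrite e1 addrK dvdzE /= dvdn1 => /eqP l1; move: l_pr; rewrite l1.
Qed.

Lemma unitmod_mull (j : nat) x y : R y -> unitmod R (l ^ j)%N (x * y) -> unitmod R (l ^ j)%N x.
Proof.
move=> Ry [z Rz [r Rr e]]; exists (y * z); first exact: qoM.
by exists r; rewrite // mulrA.
Qed.

Section Small.
Variable O' : quadOrder K.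
Hypotheses (hO : suborder R O' l 1) (ln : (l %| n)%Z).

Lemma card_class_ext_ker_ramified : (#|('ker (class_ext_morphism hO))%g| <= l)%N.
Proof.
(* For a class given by a + bw the label i is b / a modulo l; outside the kernel the label is a
   default. *)
have key c : exists i : 'I_l, c \in ('ker (class_ext_morphism hO))%g ->
    unit_class R (O' := O') l 1 (1 + (i : nat)%:R * w) c.
  case: (boolP (c \in _)) => [/kerP|_]; last by exists (Ordinal (prime_gt0 l_pr)).
  move=> /(_ (in_setT _)) /(class_ext_ker_unit l_pr) [x ux].
  have [Rx mx _] := ux; have [RE _ _] := gw.
  move: Rx mx ux => /RE [a [b ->]] mx ux.
  have la := @unitmod_coef 1 _ _ isT ln mx.
  have [u [v e]] := coprimez_inv l_pr 1 la.
  have l0 : l%:Z != 0 by case: l l_pr.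
  pose i := (b * u %% l)%Z; pose q := (b * u %/ l)%Z.
  have ei : b * u = q * l + i := divz_eq _ _.
  have il : (absz i < l)%N.
    have := @modz_ge0 (b * u) l l0; have := @ltz_pmod (b * u) l.
    by rewrite /i; move: (prime_gt0 l_pr); lia.
  have ai : (absz i)%:R = i%:~R :> K by rewrite pmulrn gez0_abs ?modz_ge0.
  exists (Ordinal il) => _ /=; rewrite ai.
  apply: (@eq_unit_class _ _ _ _ _ _ _ _ u a ((- v)%:~R + (- q)%:~R * w)
    ((a * q - b * v)%:~R * w) _ ux).
  - by have := gen_mem gw 1 i.
  - exact: (gen_mem gw).
  - exact: gen_mem_mul.
  - transitivity ((a * u - (l ^ 1)%N%:Z * v)%:~R + (b * u - q * l)%:~R * w : K).
      by rewrite e ei addrK addrAC subrr add0r.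
    by rewrite expn1 !zE /=; ring.
  - transitivity (a%:~R + (a * (b * u - q * l) + b * (1 + (l ^ 1)%N%:Z * v - a * u)
        + l%:Z * (a * q - b * v))%:~R * w : K).
      by congr (_ + _%:~R * w); rewrite expn1; ring.
    by rewrite e ei subrr expn1 !zE /=; ring.
(* The label determines the class, so the labelling is injective on the kernel. *)
have [i hi] := choice key.
rewrite -[X in (_ <= X)%N]card_ord; apply: (@leq_card_in _ _ i).
move=> c d /hi uc /hi ud e; rewrite e in uc; exact: unit_class_inj uc ud erefl.
Qed.

End Small.

Section Unramified.
Variable O' : quadOrder K.
Hypotheses (hO : suborder R O' l 1) (ld : ~~ (l %| t ^+ 2 - 4 * n)%Z).

Lemma residue_mapX (F : fieldType) (f : K -> F) k x : residue_map R f -> R x ->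
  f (x ^+ k) = f x ^+ k.
Proof.
case=> fD fM fZ Rx; elim: k => [|k ih]; first by rewrite !expr0; exact: (fZ 1).
by rewrite !exprS fM ?ih //; apply: qoX.
Qed.

Lemma int_Frobenius (F : fieldType) (k : int) : l \in [pchar F] -> (k%:~R : F) ^+ l = k%:~R.
Proof. by move=> lF; rewrite -(pFrobenius_autE lF) rmorph_int. Qed.

(** Frobenius fixes the images of [t] and [n], hence sends [r] to [r] or [s]; in both cases its
    square fixes [r]. *)
Lemma root_Frobenius2 (F : fieldType) (r s : F) : l \in [pchar F] ->
  r + s = t%:~R -> r * s = n%:~R -> r ^+ (l * l) = r.
Proof.
move=> lF e1 e2; rewrite exprM.
have phiE x : x ^+ l = pFrobenius_aut lF x by rewrite pFrobenius_autE.
have : (r ^+ l - r) * (r ^+ l - s) = 0.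
  transitivity ((r ^+ l) ^+ 2 - t%:~R * r ^+ l + n%:~R); first by rewrite -e1 -e2; ring.
  rewrite -[t%:~R](int_Frobenius t lF) -[n%:~R](int_Frobenius n lF) -e1 -e2.
  by rewrite !phiE -rmorphXn -rmorphM -rmorphB -rmorphD /= -(rmorph0 (pFrobenius_aut lF)); congr (pFrobenius_aut lF _); ring.
move/eqP; rewrite mulf_eq0 !subr_eq0 => /orP[] /eqP e; rewrite e ?e //.
have -> : s = t%:~R - r by rewrite -e1; ring.
by rewrite phiE rmorphB /= -!phiE int_Frobenius // e -e1; ring.
Qed.

(** Both residue maps kill x^(l^2) - x = a + bw. As (f w - g w)^2 = t^2 - 4n is nonzero in [F], the
    two equations force l to divide [a] and [b]. *)
Lemma Frobenius2_mod x : R x -> exists2 r, R r & x ^+ (l * l) = x + l%:R * r.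
Proof.
move=> Rx; have [F [f [g [lF hf hg e1 e2]]]] := residue_maps l_pr gw.
have [RE _ _] := gw.
have Rw : R w by have := gen_mem gw 0 1; rewrite mul1r add0r.
have fix0 h : residue_map R h -> h w ^+ (l * l) = h w :> F -> h (x ^+ (l * l) - x) = 0.
  move=> hh hw; have [hD hM hZ] := hh.
  have Rl : R (x ^+ (l * l)) by apply: qoX.
  have hN y : R y -> h (- y) = - h y.
    move=> Ry; rewrite -mulN1r (hM (-1) y) ?mulN1r //; last exact: (qoZ R (-1)).
    by rewrite (hZ (-1)) mulN1r.
  rewrite hD ?hN ?residue_mapX //; last exact: qoN.
  move: Rx => /RE [a [b ->]].
  rewrite hD ?hM ?hZ //; try exact: qoZ; try exact: gen_mem_mul.
  have phiE y : y ^+ l = pFrobenius_aut lF y by rewrite pFrobenius_autE.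
  have -> : (a%:~R + b%:~R * h w) ^+ (l * l) = a%:~R + b%:~R * h w ^+ (l * l).
    by rewrite !exprM !phiE !rmorphD !rmorphM /= !rmorph_int.
  by rewrite hw subrr.
have zf := fix0 f hf (root_Frobenius2 lF e1 e2).
have zg : g (x ^+ (l * l) - x) = 0.
  by apply: fix0 hg _; apply: (@root_Frobenius2 _ _ (f w)) => //; rewrite 1?addrC 1?mulrC.
have : R (x ^+ (l * l) - x) by apply: qoB => //; apply: qoX.
have [fD fM fZ] := hf; have [gD gM gZ] := hg.
move=> /RE [a [b e]]; move: zf zg; rewrite e fD ?fM ?fZ ?gD ?gM ?gZ;
  try exact: qoZ; try exact: gen_mem_mul; rewrite ?Rw //.
move=> zf zg.
have d0 : (f w - g w) != 0.
  have : (t ^+ 2 - 4 * n)%:~R != 0 :> F by rewrite (int_pchar _ lF).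
  apply: contraNneq => d0; rewrite !zE -e1 -e2 /=.
  have -> : f w = g w by apply/eqP; rewrite -subr_eq0 d0.
  by apply/eqP; ring.
have b0 : b%:~R == 0 :> F.
  have : b%:~R * (f w - g w) = 0.
    by rewrite -[RHS](subrr 0) -{1}zf -zg; ring.
  by move/eqP; rewrite mulf_eq0 (negPf d0) orbF.
have a0 : a%:~R == 0 :> F by move: zf; rewrite (eqP b0) mul0r addr0 => ->.
move: a0 b0; rewrite !(int_pchar _ lF) => /dvdzP [a' ea] /dvdzP [b' eb].
exists (a'%:~R + b'%:~R * w); first exact: (gen_mem gw).
by rewrite -[LHS](subrK x) e ea eb !zE /=; ring.
Qed.

(** Since x^(l^2) = x modulo lR, the class satisfies c^(l^2) = c, so c^l is an l-th root of c. *)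
Lemma class_ext_ker_unramified c : class_ext hO c = 1%g -> exists d, c = (d ^+ l)%g.
Proof.
move=> /(class_ext_ker_unit l_pr) [x ux]; exists (c ^+ l)%g.
have [Rx _ _] := ux; have [r Rr e] := Frobenius2_mod Rx.
rewrite -expgM; apply: (unit_class_inj ux _ erefl).
apply: (@eq_unit_class _ _ _ _ _ _ _ _ 1 1 (- r) r Rx (unit_classX hO (l * l) ux)) => //.
- exact: qoN.
- by rewrite e expn1; ring.
- by rewrite e expn1; ring.
Qed.

End Unramified.

Section Powers.
Hypotheses (l3 : (3 <= l)%N) (lt : (l %| t)%Z) (ln : (l %| n)%Z).
Hypothesis h3 : l = 3%N -> ~~ (9 %| 3 + 3 * t + t ^+ 2 - n)%Z.

Lemma gen_pow k : exists p q : int, [/\ w ^+ k = p%:~R + q%:~R * w,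
  (0 < k)%N -> (l %| p)%Z, (1 < k)%N -> (l %| q)%Z,
  (2 < k)%N -> (l%:Z * l %| p)%Z & (3 < k)%N -> (l%:Z * l %| q)%Z].
Proof.
elim: k => [|k [p [q [e h1 h2 h5 h4]]]].
  by exists 1, 0; rewrite expr0 mul0r addr0.
exists (- (n * q)), (p + t * q); split.
- case: gw => _ w2 _; rewrite exprS e !zE.
  have -> : n%:~R = t%:~R * w - w ^+ 2 by rewrite w2; ring.
  by ring.
- by move=> _; rewrite rpredN; apply: dvdz_mulr.
- by move=> k1; apply: rpredD; [exact: h1 | exact: dvdz_mulr].
- by move=> k2; rewrite rpredN; apply: dvdz_mul => //; apply: h2.
- by move=> k3; apply: rpredD; [exact: h5 | apply: dvdz_mul => //; exact/h2/ltnW].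
Qed.

(** In the binomial expansion the linear term is lw. The terms of degree 2 to l - 1 carry l both in
    the binomial coefficient and in the coefficient of w, and w^l carries l^2 there when l >= 5. For
    l = 3 the coefficient of w is 3 + 3t + t^2 - n, whence the hypothesis [h3]. *)
Lemma pow_one_add : exists A B : int, [/\ (1 + w) ^+ l = A%:~R + (l%:Z * B)%:~R * w,
  ~~ (l %| A)%Z & ~~ (l %| B)%Z].
Proof.
have l_gt1 := prime_gt1 l_pr.
have nd (A k : int) : A = 1 + l%:Z * k -> ~~ (l %| A)%Z.
  move=> ->; rewrite rpredDr ?dvdz_mulr //.
  by rewrite dvdzE /= dvdn1; case: l l_gt1 => [|[]].
have [l_3|l_n3] := eqVneq l 3%N.
  have [t' et] : exists t', t = t' * 3 by case/dvdzP: lt => t'; rewrite l_3; exists t'.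
  have [n' en] : exists n', n = n' * 3 by case/dvdzP: ln => n'; rewrite l_3; exists n'.
  have eB : 3 * (1 + t + t' * t - n') = 3 + 3 * t + t ^+ 2 - n by rewrite et en; ring.
  exists (1 - 3 * n - t * n), (1 + t + t' * t - n'); split.
  - case: gw => _ w2 _; rewrite l_3 -[3%:Z]/(3 : int) eB.
    have w3 : w ^+ 3 = t%:~R * (t%:~R * w - n%:~R) - n%:~R * w.
      by rewrite exprS w2 -[n%:~R * w]mulrC mulrBr mulrCA -expr2 w2.
    transitivity (1 + 3 * w + 3 * w ^+ 2 + w ^+ 3); first by ring.
    by rewrite w3 w2 !zE /=; ring.
  - by apply: (nd _ (- (3 * n') - t * n')); rewrite l_3 -[3%:Z]/(3 : int) en; ring.
  apply: contra (h3 l_3) => /dvdzP [k ek]; rewrite -eB ek l_3.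
  by apply/dvdzP; exists k; lia.
(* [S] is lZ + l^2 Zw, which contains all terms of degree at least 2. *)
pose S z := exists u v : int, z = (l%:Z * u)%:~R + (l%:Z * l * v)%:~R * w.
have [u [v e]] : S (\sum_(i < l.-1) w ^+ i.+2 *+ 'C(l, i.+2)).
  apply: (big_ind S).
  - by exists 0, 0; rewrite !mulr0 mul0r addr0.
  - move=> x y [u [v ->]] [u' [v' ->]]; exists (u + u'), (v + v').
    by rewrite !zE; ring.
  move=> i _; have il : (i.+2 <= l)%N by have := ltn_ord i; lia.
  move: (i.+2) (isT : (1 < i.+2)%N) il => k k1 {i}.
  have [p [q [-> /(_ (ltnW k1)) /dvdzP[p' ep] /(_ k1) /dvdzP[q' eq] _ h4]]] := gen_pow k.
  rewrite leq_eqVlt => /orP[/eqP il|il].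
    have /h4 /dvdzP [q2 eq2] : (3 < k)%N.
      have l4 : l != 4%N by apply: contraTneq l_pr => ->.
      by move: l_n3 l4 l3; rewrite il; lia.
    exists p', q2; rewrite il binn mulr1n ep eq2 !zE /=; ring.
  have /dvdnP [c ec] : (l %| 'C(l, k))%N by apply: prime_dvd_bin; rewrite // ltnW.
  exists (p * c), (q' * c); rewrite ec -mulr_natr eq natrM !zE -!pmulrn; ring.
exists (1 + l%:Z * u), (1 + l%:Z * v); split; try exact: nd.
have sumE k : (1 + w) ^+ k.+1 =
    1 + (w *+ k.+1 + \sum_(i < k) w ^+ i.+2 *+ 'C(k.+1, i.+2)).
  rewrite [1 + w]addrC exprD1n big_ord_recl /= bin0 expr0 mulr1n; congr (_ + _).
  by rewrite big_ord_recl /= bin1.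
have := sumE l.-1; rewrite prednK ?prime_gt0 // e => ->.
by rewrite -[w *+ l]mulr_natl !zE /=; ring.
Qed.

Variables (R1 O' : quadOrder K).
Hypotheses (h1 : suborder R R1 l 1) (h2 : suborder R O' l 2) (h12 : suborder R1 O' l 1).

(** Multiplication by an inverse [u] of [a] modulo l^2 makes the constant coordinate 1 and keeps the
    factor l of the other one. *)
Lemma unit_class_normalize (a b : int) c : unit_class R (O' := O') l 2 (a%:~R + (l%:Z * b)%:~R * w) c ->
  exists2 u : int, ~~ (l %| u)%Z & unit_class R (O' := O') l 2 (1 + (l%:Z * (b * u))%:~R * w) c.
Proof.
move=> uc; have [_ mx _] := uc.
have [u [v e]] := coprimez_inv l_pr 2 (@unitmod_coef 2 _ _ isT ln mx).
exists u.
  apply/negP => /(dvdz_mull a); rewrite e rpredDr.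
    by rewrite dvdzE /= dvdn1 => /eqP l1; move: l_pr; rewrite l1.
  by apply: dvdz_mulr; rewrite dvdzE /= dvdn_exp.
apply: (@eq_unit_class _ _ _ _ _ _ _ _ u a (- v)%:~R
    ((- (l%:Z * b * v))%:~R * w) _ uc).
- exact: (gen_mem gw 1).
- exact: qoZ.
- exact: gen_mem_mul.
- transitivity ((a * u - (l ^ 2)%N%:Z * v)%:~R + (l%:Z * (b * u))%:~R * w : K).
    by rewrite e addrK.
  by rewrite !zE /=; ring.
- transitivity (a%:~R + (l%:Z * b * (1 + (l ^ 2)%N%:Z * v) - (l%:Z * b * v) * (l ^ 2)%N%:Z)%:~R * w : K).
    by congr (_ + _%:~R * w); ring.
  by rewrite -e !zE /=; ring.
Qed.

(** Products of two terms lbw are divisible by l^2, so the elements 1 + lbw multiply by adding their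
    values of [b]. *)
Lemma expr_one_add_mod (b : int) (k : nat) : exists2 r, R r &
  (1 + (l%:Z * b)%:~R * w) ^+ k = 1 + (l%:Z * (k%:Z * b))%:~R * w + (l ^ 2)%N%:R * r.
Proof.
have [RE w2 _] := gw; have Rl : R (l ^ 2)%N%:R := qoZ R (l ^ 2)%N.
have Rw := gen_mem_mul.
elim: k => [|k [r Rr e]].
  by exists 0; [exact: qo0 | rewrite expr0 mul0r mulr0 mul0r mulr0 !addr0].
have Rww : R ((k%:Z * b * b)%:~R * w * w) .
  by apply: qoM => //; have := Rw 1; rewrite mul1r.
exists ((k%:Z * b * b)%:~R * w * w + (1 + (l%:Z * b)%:~R * w) * r).
  apply: qoD => //; apply: qoM => //; exact: (gen_mem gw 1).
rewrite exprS e natrX intS !zE /=; ring.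
Qed.

(** Every class in the kernel comes from some 1 + lb'w modulo l^2 R. The l-th power of the class [g]
    of 1 + w comes from 1 + l beta w with [beta] prime to l, so every class in the kernel is a power
    of g^l. *)
Lemma class_ext_ker_powers c : class_ext h12 c = 1%g -> exists d, c = (d ^+ l)%g.
Proof.
case/class_ext_ker => I ec RI.
have aR := qo_addsub R; have aR1 := qo_addsub R1.
(* In two stages, RI = R (R1 I) = R R1 = R. *)
have RI0 : smul R I = R.
  by rewrite -{2}(smul_suborder h1) -RI smulA ?(smul_suborder h1) //; exact/frac_addsub/(pid_fractional I).
have [x [Ix Rx mx eI]] := ext_trivial l_pr h2 RI0.
have uc : unit_class R (O' := O') l 2 x c by split=> //; exists I.
have R1x : R1 x.
  by rewrite -[R1 x]/((R1 : set K) x) -RI -[x]mul1r; apply: smul_mem => //; apply: qo1.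
have [RE _ _] := gw.
have [a [b ex]] : exists a b : int, x = a%:~R + (l%:Z * b)%:~R * w.
  case/h1: R1x => a [_ /RE [p [q ->]] ->]; exists (a + l%:Z * p), q.
  by rewrite expn1 !zE /=; ring.
have [A [B [ey nA nB]]] := pow_one_add.
have R1w : R (1 + w) by have := gen_mem gw 1 1; rewrite mul1r.
(* The norm of the l-th power is A^2 modulo l, which is prime to l. *)
have my : unitmod R (l ^ 2)%N (1 + w).
  apply: (@unitmod_mull _ _ ((1 + w) ^+ l.-1)); first exact: qoX.
  rewrite -exprS prednK ?prime_gt0 // ey.
  apply: (unitmod_int l_pr _ (gen_mem gw _ _) (gen_norm_eq _ _)).
  have -> : A ^+ 2 + t * A * (l%:Z * B) + n * (l%:Z * B) ^+ 2 =
    l%:Z * (t * A * B + n * l%:Z * B ^+ 2) + A ^+ 2 by ring.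
  rewrite rpredDl; last exact: dvdz_mulr.
  by move: nA; rewrite !dvdzE abszX /= Euclid_dvdX // andbT.
have [g ug] := unit_class_exists l_pr h2 R1w my.
have := unit_classX h2 l ug; rewrite ey => /unit_class_normalize [u nu].
set beta := B * u => ub.
have nbeta : ~~ (l %| beta)%Z.
  by rewrite dvdzE abszM /= Euclid_dvdM // negb_or; rewrite !dvdzE /= in nB nu *; rewrite nB nu.
rewrite ex in uc; have [u' _ {}uc] := unit_class_normalize uc.
move: (b * u') uc => b' uc.
(* [k] will be b' / beta modulo l, which makes (g^l)^k the class of 1 + lb'w. *)
have [v [v' ev]] := coprimez_inv l_pr 1 nbeta.
have l0 : l%:Z != 0 by case: l l_pr.
pose k := absz (b' * v %% l)%Z; pose q := (b' * v %/ l)%Z.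
have ek : b' * v = q * l + k%:Z.
  by rewrite /k gez0_abs ?modz_ge0 //; apply: divz_eq.
have ekb : k%:Z * beta = b' + l%:Z * (b' * v' - q * beta).
  transitivity (b' * (beta * v) - q * l * beta).
    by rewrite [b' * _]mulrCA ek; ring.
  by rewrite ev expn1; ring.
have [r Rr er] := expr_one_add_mod beta k.
exists (g ^+ k)%g; rewrite -expgM mulnC expgM.
apply: (unit_class_inj uc _ erefl).
apply: (@eq_unit_class _ _ _ _ _ _ _ _ 1 1 (- ((b' * v' - q * beta)%:~R * w + r)) ((b' * v' - q * beta)%:~R * w + r) _
  (unit_classX h2 k ub)).
- exact: (gen_mem gw 1).
- by apply/qoN/qoD => //; apply: gen_mem_mul.
- by apply/qoD => //; apply: gen_mem_mul.
- by rewrite er ekb natrX !zE /=; ring.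
- by rewrite er ekb natrX !zE /=; ring.
Qed.

End Powers.

End Generated.

Lemma dvdz_primeM (l : nat) (a b : int) : prime l ->
  (l %| a * b)%Z = (l %| a)%Z || (l %| b)%Z.
Proof. by move=> l_pr; rewrite !dvdzE abszM Euclid_dvdM. Qed.

(** * Changes of generator *)

Section Shift.
Variables (K : imQuadField) (R : quadOrder K) (w : K) (t n : int).
Hypothesis gw : qo_gen R w t n.

Lemma qo_gen_conductor (O' : quadOrder K) (f : nat) : (0 < f)%N ->
  (forall x : K, O' x <-> exists a : int, exists2 y, R y & x = a%:~R + f%:R * y) ->
  qo_gen O' (f%:R * w) (f%:Z * t) (f%:Z ^+ 2 * n).
Proof.
case: gw => RE w2 inj f0 OE; split.
- move=> x; rewrite OE; split=> [[a [y /RE [p [q ->]] ->]]|[a [b ->]]].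
    by exists (a + f%:Z * p), q; rewrite !zE /=; ring.
  exists a, (b%:~R * w); last by ring.
  by apply/RE; exists 0, b; rewrite add0r.
- by rewrite exprMn w2 !zE /=; ring.
- move=> a b a' b' e.
  have [-> /eqP] : a = a' /\ b * f%:Z = b' * f%:Z.
    by apply: inj; rewrite !zM -!mulrA.
  by rewrite -subr_eq0 -mulrBl mulf_eq0 subr_eq0 => /orP[/eqP->|] //; case: (f) f0.
Qed.

(** The shift keeps t^2 - 4n; it serves to make an odd prime l divide the trace, hence also the norm
    when l divides t^2 - 4n. *)
Lemma qo_gen_shift (k : int) :
  qo_gen R (w + k%:~R) (t + 2 * k) (n + t * k + k ^+ 2).
Proof.
case: gw => RE w2 inj; split.
- move=> x; rewrite RE; split=> -[a [b ->]].
    by exists (a - b * k), b; rewrite !zE; ring.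
  by exists (a + b * k), b; rewrite !zE; ring.
- rewrite !zE; have -> : n%:~R = t%:~R * w - w ^+ 2 by rewrite w2; ring.
  by ring.
- move=> a b a' b' e; case: (inj (a + b * k) b (a' + b' * k) b').
    transitivity (a%:~R + b%:~R * (w + k%:~R)); first by rewrite !zE; ring.
    by rewrite e !zE; ring.
  by move=> h hb; rewrite hb in h *; move/addIr: h.
Qed.

End Shift.

(** * The maximal order, its discriminant and the decomposition of l *)

Section MaximalOrder.
Variables (K : imQuadField) (D : int).
Hypothesis hD : is_discriminant K D.
Local Notation ia := (in_alg K).
Local Notation OK := (@ringOfIntegers K).

Lemma maximal_order_exists : exists O : quadOrder K, (O : set K) = OK.
Proof.
case: hD => b [bb bE _].
have o1 : OK 1 by apply: integral1.
have oB x y : OK x -> OK y -> OK (x - y) by apply: integral_sub.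
have oM x y : OK x -> OK y -> OK (x * y) by apply: integral_mul.
have fg : exists g : seq K, forall x, OK x <->
    exists a : nat -> int, x = \sum_(i < size g) g`_i *~ a i.
  exists b => x; rewrite bE size_tuple; split=> -[a ->].
    exists (fun k => a (inord k)); apply: eq_bigr => i _; by rewrite inord_val.
  by exists (fun i => a i).
have bs : exists2 b : seq K, basis_of {: K} b & forall x, x \in b -> OK x.
  exists b => // x /tnthP [i ->]; apply/bE.
  exists (fun j => (j == i)%:Z); rewrite (bigD1 i) //= eqxx big1 ?addr0 => [|j /negPf ->] //.
  by rewrite (tnth_nth 0).
by exists (QuadOrder o1 oB oM fg bs).
Qed.

Variables (R : quadOrder K) (RE : (R : set K) = OK).
Variables (w : K) (t n : int).
Hypotheses (gw : qo_gen R w t n).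
Hypothesis injQ : forall u v u' v', ia u + ia v * w = ia u' + ia v' * w -> u = u' /\ v = v'.

Lemma free_gen : free [:: 1; w].
Proof.
rewrite -[[:: _; _]]/(tval [tuple 1; w]); apply/freeP => k.
rewrite !big_ord_recl big_ord0 addr0 /= => e i.
have [|k0 k1] := @injQ (k ord0) (k (lift ord0 ord0)) 0 0.
  by rewrite !rmorph0 mul0r addr0 -e -[k ord0 *: 1]/(ia _) mulr_algl.
by case: (unliftP ord0 i) => [j ->|->] //; rewrite (ord1 j).
Qed.

(** Multiplication by w sends 1 to w and w to tw - n, so its diagonal entries are 0 and t. The
    length [m] is a variable because [\dim {: K}] equals 2 only through a proof. *)
Lemma trace_gen (m : nat) (b : m.-tuple K) : m = 2%N -> tval b = [:: 1; w] ->
  \sum_(i < m) coord b i (w * b`_i) = t%:~R.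
Proof.
move=> m2; subst m => eb; have fb : free b by rewrite eb free_gen.
have c0 (i j : 'I_2) : coord b i b`_j = (i == j)%:R by rewrite coord_free // eq_sym.
rewrite !big_ord_recl big_ord0 addr0 /= eb /= mulr1.
have e0 : 1 = b`_(ord0 : 'I_2) by rewrite eb.
have e1 : w = b`_(lift ord0 ord0 : 'I_2) by rewrite eb.
case: gw => _ w2 _; rewrite -expr2 w2.
rewrite [in X in X + _]e1 c0 add0r raddfB /= -[t%:~R]iaZ -[n%:~R]iaZ mulr_algl.
rewrite -[ia n%:~R]/(_ *: 1) !linearZ /= {1}e1 {1}e0 !c0 /=.
by rewrite /GRing.scale /= mulr1 mulr0 subr0.
Qed.

Lemma fieldTraceE (a b : int) : fieldTrace (a%:~R + b%:~R * w) = (2 * a + t * b)%:~R.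
Proof.
pose ft (x : K) := \tr (passmx.mxof (vbasis {: K}) (vbasis {: K}) (amull x)).
rewrite -[fieldTrace _]/(ft _).
have ftD x y : ft (x + y) = ft x + ft y by rewrite /ft raddfD raddfD raddfD.
have ftZ k x : ft (k%:~R * x) = k%:~R * ft x.
  by rewrite mulrzl /ft !raddfMz mulrzl.
have ft1 : ft 1 = 2.
  rewrite /ft amull1 passmx.mxof1 ?(basis_free (vbasisP _)) // mxtrace1 iq_dim //.
have ftw : ft w = t%:~R.
  have sb : size [:: 1; w] == \dim {: K} by rewrite iq_dim.
  pose b' : (\dim {: K}).-tuple K := Tuple sb.
  have bb : basis_of {: K} b'.
    by rewrite basisEfree free_gen subvf /= iq_dim.
  have fb := basis_free bb; have bv := vbasisP {: K}.
  rewrite -(trace_gen (b := b') (iq_dim K) erefl) /ft.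
  set e := vbasis {: K}.
  (* Inserting identities passes from [vbasis] to the basis (1, w), and the cyclicity of the trace
     cancels the base changes. *)
  have -> : amull w = (\1 \o (amull w \o \1))%VF by rewrite comp_lfun1l comp_lfun1r.
  rewrite (@passmx.mxof_comp _ _ _ _ _ b') // (@passmx.mxof_comp _ _ _ _ _ b') //.
  rewrite -mulmxA mxtrace_mulC -mulmxA -(passmx.mxof_comp b' b') //.
  rewrite comp_lfun1l passmx.mxof1 // mulmx1.
  apply: eq_bigr => i _; rewrite mxE /= passmx.vecof_delta mxE lfunE /= //.
by rewrite -[a%:~R]mulr1 ftD !ftZ ft1 ftw !zE /=; ring.
Qed.

(** t^2 - 4n is the determinant of the trace form on (1, w), and [k] that of the integer matrix
    expressing the given Z-basis in (1, w). *)
Lemma discriminant_square : exists k : int, D = k ^+ 2 * (t ^+ 2 - 4 * n).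
Proof.
case: hD => b [bb bE]; case: (gw) => GE w2 _.
have co i : (i < 2)%N -> exists p : int * int, b`_i = p.1%:~R + p.2%:~R * w.
  move=> i2; have /GE [p [q e]] : R b`_i.
    rewrite -[R _]/((R : set K) _) RE; apply/bE.
    exists (fun j : 'I_2 => (j == Ordinal i2)%:Z); rewrite (bigD1 (Ordinal i2)) //= eqxx.
    by rewrite big1 ?addr0 => [|j /negPf ->].
  by exists (p, q).
have [[p q] /= e0] := co 0%N isT; have [[p' q'] /= e1] := co 1%N isT.
rewrite (expand_det_row _ ord0) !big_ord_recl big_ord0 /cofactor !det_mx11 !mxE /=.
rewrite !e0 !e1.
have TE (a a' c c' : int) : fieldTrace ((a%:~R + a'%:~R * w) * (c%:~R + c'%:~R * w)) =
    (2 * a * c + t * (a * c' + a' * c) + (t ^+ 2 - 2 * n) * a' * c')%:~R.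
  have -> : (a%:~R + a'%:~R * w) * (c%:~R + c'%:~R * w) =
    (a * c - a' * c' * n)%:~R + (a * c' + a' * c + t * a' * c')%:~R * w.
    rewrite !zE; have -> : n%:~R = t%:~R * w - w ^+ 2 by rewrite w2; ring.
    ring.
  by rewrite fieldTraceE; congr (_%:~R); ring.
rewrite !TE /= => eD; exists (p * q' - p' * q); apply: (@intr_inj rat); rewrite eD.
rewrite !addn0 !addr0 expr0 /bump /= expr1 !zE /=; ring.
Qed.

Variables (l : nat) (l_pr : prime l) (l3 : (3 <= l)%N).
Local Notation Delta := (t ^+ 2 - 4 * n).

Lemma mem_OK x : R x <-> OK x.
Proof. by rewrite -[R x]/((R : set K) x) RE. Qed.

Lemma rational_idealP (a b : int) : @rational_ideal K l (a%:~R + b%:~R * w) <->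
  (l %| a)%Z /\ (l %| b)%Z.
Proof.
case: (gw) => GE _ inj; split.
  case=> y /mem_OK /GE [p [q ->]] e; case: (inj a b (l%:Z * p) (l%:Z * q)).
    by rewrite e !zE /=; ring.
  by move=> -> ->; rewrite !dvdz_mulr.
case=> /dvdzP [p ->] /dvdzP [q ->]; exists (p%:~R + q%:~R * w).
  by apply/mem_OK/GE; exists p, q.
by rewrite !zE /=; ring.
Qed.

(** P contains some x = a + bw outside the ideal of l, as otherwise l would be divisible by l^2. The
    coordinates of x^2 show that l divides a^2 - b^2 n and b (2a + bt), but not b; then l divides
    b^2 (t^2 - 4n) = 4 (a^2 - b^2 n) - (2a - bt)(2a + bt). *)
Lemma ramified_dvd_disc : ramified_prime K l -> (l %| Delta)%Z.
Proof.
case: (gw) => GE w2 inj; case=> P [PO [P0 PB] PM P1 _] eP.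
have [x Px nx] : exists2 x, P x & ~ @rational_ideal K l x.
  apply: contrapT => nex.
  have PR x : P x -> @rational_ideal K l x.
    by move=> Px; apply: contrapT => nx; apply: nex; exists x.
  pose C x := exists2 y, R y & x = l%:R * (l%:R * y).
  have aC : addsub C.
    split; first by exists 0; rewrite ?mulr0 //; apply: qo0.
    by move=> x y [u Ru ->] [v Rv ->]; exists (u - v); [apply: qoB | ring].
  have : C (l%:R * 1).
    have : @rational_ideal K l (l%:R * 1) by exists 1 => //; apply/mem_OK/qo1.
    rewrite eP; apply: smul_ind => // u v /PR [u' /mem_OK hu ->] /PR [v' /mem_OK hv ->].
    by exists (u' * v'); [exact: qoM | ring].
  have lK : l%:R != 0 :> K by rewrite -iaR fmorph_eq0 pnatr_eq0; case: (l) l_pr.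
  case=> y /GE [a [b ->]] /(mulfI lK) e.
  have [|e1 _] := inj 1 0 (l%:Z * a) (l%:Z * b).
    transitivity (1 : K); first by rewrite mul0r addr0.
    by rewrite {1}e !zE /=; ring.
  have : (l %| 1)%Z by apply/dvdzP; exists a; rewrite mulrC -e1.
  by rewrite dvdzE /= dvdn1 => /eqP l1; move: l_pr; rewrite l1.
have /mem_OK /GE [a [b ex]] := PO _ Px.
have : @rational_ideal K l ((a ^+ 2 - b ^+ 2 * n)%:~R + (b * (2 * a + b * t))%:~R * w).
  have -> : (a ^+ 2 - b ^+ 2 * n)%:~R + (b * (2 * a + b * t))%:~R * w = x * x.
    rewrite ex !zE; have -> : n%:~R = t%:~R * w - w ^+ 2 by rewrite w2; ring.
    ring.
  by rewrite eP; apply: smul_mem.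
move/rational_idealP => [h1 h2].
have nb : ~~ (l %| b)%Z.
  apply/negP => lb; apply: nx; rewrite ex; apply/rational_idealP; split=> //.
  have : (l %| a ^+ 2)%Z by rewrite -(subrK (b ^+ 2 * n) (a ^+ 2)) rpredD // -mulrA dvdz_mulr.
  by rewrite expr2 dvdz_primeM // orbb.
move: h2; rewrite dvdz_primeM // (negPf nb) /= => h2.
have : (l %| b * (b * Delta))%Z.
  have -> : b * (b * Delta) = 4 * (a ^+ 2 - b ^+ 2 * n) - (2 * a - b * t) * (2 * a + b * t) by ring.
  by rewrite rpredB // dvdz_mull.
by rewrite !dvdz_primeM // (negPf nb).
Qed.

Let delta := (- t)%:~R + (2 : int)%:~R * w.

Lemma delta_sq : delta * delta = Delta%:~R.
Proof.
case: (gw) => GE w2 inj; rewrite /delta !zE.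
have -> : n%:~R = t%:~R * w - w ^+ 2 by rewrite w2; ring.
by rewrite /=; ring.
Qed.

(** The square of [delta] is t^2 - 4n, a multiple of l and so an element of P. *)
Lemma delta_mem P : prime_ideal P -> (forall x, @rational_ideal K l x -> P x) ->
  (l %| Delta)%Z -> P delta.
Proof.
case=> PO [P0 PB] PM P1 Ppr lP ld.
have : P (delta * delta).
  apply: lP; rewrite delta_sq; have := @rational_idealP Delta 0.
  by rewrite mul0r addr0 => -[_ h]; apply: h.
have od : OK delta by apply/mem_OK; case: (gw) => GE _ _; apply/GE; exists (- t), 2.
by case/Ppr.
Qed.

Lemma half_odd : exists h : nat, l = (2 * h + 1)%N.
Proof.
exists l./2; rewrite mul2n -{1}(odd_double_half l) addnC; congr addn.
by case: (even_prime l_pr) => [e|->] //; move: l3; rewrite e.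
Qed.

(* Both ideals equal (l, delta): if x is in P, then 2x = u + b delta with u an integer
   of P, so that l divides u. *)
Lemma prime_ideal_sub P Q : prime_ideal P -> prime_ideal Q ->
  (forall x, @rational_ideal K l x -> P x) -> (forall x, @rational_ideal K l x -> Q x) ->
  (l %| Delta)%Z -> forall x, P x -> Q x.
Proof.
move=> pP pQ lP lQ ld x Px; have dP := delta_mem pP lP ld; have dQ := delta_mem pQ lQ ld.
case: pP => PO [P0 PB] PM P1 _; case: pQ => QO [Q0 QB] QM Q1 _.
have oZ (k : int) : OK k%:~R by apply/mem_OK/qoZ.
have /mem_OK := PO _ Px; case: (gw) => GE _ _ /GE [a [b ex]].
have e2 : (2 * a + b * t)%:~R = (2 : int)%:~R * x - b%:~R * delta.
  by rewrite ex /delta !zE /=; ring.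
have Pu : P (2 * a + b * t)%:~R by rewrite e2; apply: PB; apply: (PM).
have aP : addsub P by []. have aQ : addsub Q by [].
have Zl (k : int) : (l %| k)%Z -> @rational_ideal K l k%:~R.
  by move=> lk; have := @rational_idealP k 0; rewrite mul0r addr0 => -[_ h]; apply: h.
have lu : (l %| 2 * a + b * t)%Z.
  apply/negPn/negP => /(coprimez_inv l_pr 1) [u [v e]]; apply: P1.
  have -> : 1 = u%:~R * (2 * a + b * t)%:~R - (l%:Z * v)%:~R :> K.
    by rewrite -zM [u * _]mulrC e expn1 !zE /=; ring.
  by apply: PB; [apply: PM | apply/lP/Zl; rewrite dvdz_mulr].
have Q2x : Q ((2 : int)%:~R * x).
  rewrite -[_ * x](subrK (b%:~R * delta)) -e2; apply: addsubD => //.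
    exact/lQ/Zl.
  exact: QM.
(* Since l = 2h + 1, x = lx - h (2x) with both terms in Q. *)
have [h eh] := half_odd.
have -> : x = l%:R * x - (h%:Z)%:~R * ((2 : int)%:~R * x).
  by rewrite eh natrD natrM /=; ring.
apply: QB; last exact: QM.
by apply: lQ; exists x => //; apply: PO.
Qed.

(** Suppose that l divides t^2 - 4n. If l splits, [prime_ideal_sub] in both directions gives P = Q;
    if l is inert, 2w - t lies in the ideal of l, so l divides 2. *)
Lemma split_inert_disc : split_prime K l \/ inert_prime K l -> ~~ (l %| Delta)%Z.
Proof.
move=> h; apply/negP => ld; case: h => [[P [Q [pP pQ nPQ eP]]]|iK].
  have lP x : @rational_ideal K l x -> P x.
    case: (pP) => PO aP PM _ _; case: pQ => QO _ _ _ _.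
    rewrite eP; apply: smul_ind => // a b ha hb; rewrite mulrC; apply: PM => //.
    exact: QO.
  have lQ x : @rational_ideal K l x -> Q x.
    case: (pP) => PO _ _ _ _; case: pQ => QO aQ QM _ _.
    rewrite eP; apply: smul_ind => // a b ha hb; apply: QM => //; exact: PO.
  apply: nPQ; apply/funext => x; apply/propext.
  by split; [apply: (prime_ideal_sub pP pQ) | apply: (prime_ideal_sub pQ pP)].
have /rational_idealP [_] := delta_mem iK (fun x h => h) ld.
by rewrite dvdzE /= => /dvdn_leq -/(_ isT); rewrite leqNgt l3.
Qed.

End MaximalOrder.

(** * Single steps between class groups, and the congruences modulo 9 *)

Section Steps.
Variables (K : imQuadField) (R O' : quadOrder K) (l : nat).
Hypotheses (l_pr : prime l) (hO : suborder R O' l 1).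
Variables (S : {group classGroup R}) (S' : {group classGroup O'}).
Hypotheses (sS : (l.-Sylow([set: classGroup R]) S)%g).
Hypotheses (sS' : (l.-Sylow([set: classGroup O']) S')%g).

Lemma rk_step_eq : (forall c, class_ext hO c = 1%g -> exists d, c = (d ^+ l)%g) ->
  rk l S' = rk l S.
Proof.
exact: (@rk_ker_powers _ _ _ (class_ext_morphism hO) (classGroup_abelian O')
  (classGroup_abelian R) (class_ext_surj l_pr hO) _ _ l_pr sS' sS).
Qed.

Lemma rk_step_ramified (w : K) (t n : int) : qo_gen R w t n -> (l %| n)%Z ->
  rk l S' = rk l S \/ rk l S' = (rk l S + 1)%N.
Proof.
move=> gw ln; apply: (@rk_ker_small _ _ _ (class_ext_morphism hO) (classGroup_abelian O')
  (classGroup_abelian R) (class_ext_surj l_pr hO) _ _ l_pr sS' sS).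
exact: (card_class_ext_ker_ramified l_pr gw hO ln).
Qed.

End Steps.

Lemma sqr_mod3 (x : int) : exists y : int, x ^+ 2 = 3 * y \/ (~~ (3 %| x)%Z /\ x ^+ 2 = 3 * y + 1).
Proof.
have [q [[e|e]|e]] : exists q : int, (x = 3 * q \/ x = 3 * q + 1) \/ x = 3 * q + 2.
  by exists (x %/ 3)%Z; lia.
- by exists (3 * q ^+ 2); left; rewrite e; ring.
- by exists (3 * q ^+ 2 + 2 * q); right; split; [lia | rewrite e; ring].
- by exists (3 * q ^+ 2 + 4 * q + 1); right; split; [lia | rewrite e; ring].
Qed.

(** If 9 divided this value, then t^2 - 4n would be 6 modulo 9. But c^2 D = k^2 (t^2 - 4n), where
    the left side is 3 modulo 9 because c^2 = 1 modulo 3, and the right side would be 0 or 6. *)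
Lemma disc_mod9 (c k D d t n : int) : ~~ (3 %| c)%Z -> (3 %| t)%Z -> (D = 3 %[mod 9])%Z ->
  D = k ^+ 2 * d -> t ^+ 2 - 4 * n = c ^+ 2 * d -> ~~ (9 %| 3 + 3 * t + t ^+ 2 - n)%Z.
Proof.
move=> c3 t3 D9 eD ed; apply/negP => /dvdzP [s es].
have [t' et] : exists t', t = 3 * t' by case/dvdzP: t3 => t' ->; exists t'; lia.
have [e eD'] : exists e, D = 3 + 9 * e by exists (D %/ 9)%Z; lia.
have [y [hy|[_ hy]]] := sqr_mod3 c.
  have : (3 %| c * c)%Z by rewrite -expr2 hy; apply/dvdzP; exists y; lia.
  by rewrite (@dvdz_primeM 3) // orbb (negPf c3).
have key : c ^+ 2 * (1 + 3 * e) =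
    k ^+ 2 * (3 * t' ^+ 2 - 4 * (1 + 3 * t' + 3 * t' ^+ 2 - 3 * s)).
  apply: (@mulfI _ (3 : int)) => //.
  transitivity (c ^+ 2 * D); first by rewrite eD'; ring.
  rewrite eD mulrCA -ed.
  have -> : n = 3 + 3 * t + t ^+ 2 - s * 9 by rewrite -es; ring.
  by rewrite et; ring.
set B := 3 * t' ^+ 2 - _ in key; set C := t' ^+ 2 - 4 * (t' + t' ^+ 2 - s).
have eB : B = 3 * C - 4 by rewrite /B /C; ring.
have eL : c ^+ 2 * (1 + 3 * e) = 1 + 3 * (y + e + 3 * y * e) by rewrite hy; ring.
have [z [hz|[_ hz]]] := sqr_mod3 k.
  have eR : k ^+ 2 * B = 3 * (z * B) by rewrite hz; ring.
  by move: key; rewrite eL eR; lia.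
have eR : k ^+ 2 * B = 3 * (z * B + C) - 4 by rewrite hz {2}eB eB; ring.
by move: key; rewrite eL eR; lia.
Qed.


(** * The tower of orders of conductor c l^d *)

Lemma suborder_conductor (K : imQuadField) (O O' : quadOrder K) (f g l j : nat) :
  has_conductor O f -> has_conductor O' g -> g = (f * l ^ j)%N -> suborder O O' l j.
Proof.
move=> hO hO' eg x; rewrite hO' eg; split=> -[a [y hy ->]].
  exists a, (f%:R * y); last by rewrite natrM; ring.
  by apply/hO; exists 0, y; rewrite ?add0r.
case/hO: hy => b [z hz ->]; exists (a + (l ^ j)%N%:Z * b), z => //.
by rewrite natrM !zE /=; ring.
Qed.

Local Open Scope nat_scope.

Theorem theoremC2 (K : imQuadField) (D : int) (hD : is_discriminant K D)
  (l : nat) (l_prime : prime l) (l_ge3 : 3 <= l)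
  (c : nat) (c_coprime : coprime c l)
  (O : nat -> quadOrder K) (hO : forall d, has_conductor (O d) (c * l ^ d))
  (S : forall d, {group classGroup (O d)})
  (hS : forall d, (l.-Sylow([set: classGroup (O d)]) (S d))%g) :
  [/\ split_prime K l \/ inert_prime K l ->
        [/\ rk l (S 1) = rk l (S 0),
            rk l (S 2) = rk l (S 0) \/ rk l (S 2) = rk l (S 0) + 1 &
            forall d, 2 <= d -> rk l (S d) = rk l (S 2)],
      ramified_prime K l ->
        5 <= l \/ (l = 3 /\ (D = 3 %[mod 9])%Z) ->
        (rk l (S 1) = rk l (S 0) \/ rk l (S 1) = rk l (S 0) + 1) /\
        (forall d, 1 <= d -> rk l (S d) = rk l (S 1)) &
      ramified_prime K l -> l = 3 -> (D = 6 %[mod 9])%Z ->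
        [/\ rk l (S 1) = rk l (S 0) \/ rk l (S 1) = rk l (S 0) + 1,
            rk l (S 2) = rk l (S 1) \/ rk l (S 2) = rk l (S 1) + 1 &
            forall d, 2 <= d -> rk l (S d) = rk l (S 2)]].
Proof.
have [R RE] := maximal_order_exists hD.
have [w [t [n [GE w2 _ _ injQ]]]] := qo_struct R.
have gw : qo_gen R w t n.
  split=> // a b a' b' e; have [] := injQ a%:~R%R b%:~R%R a'%:~R%R b'%:~R%R.
    by rewrite !iaZ.
  by move=> /intr_inj -> /intr_inj ->.
have c0 : 0 < c by case: (c) c_coprime => //; rewrite /coprime gcd0n; case: (l) l_prime => [|[]].
have lc : ~~ (l %| c%:Z)%Z by rewrite dvdzE /= -prime_coprime // coprime_sym.
have gO d : qo_gen (O d) ((c * l ^ d)%N%:R * w)%R ((c * l ^ d)%N%:Z * t)%R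
    ((c * l ^ d)%N%:Z ^+ 2 * n)%R.
  apply: (qo_gen_conductor gw); first by rewrite muln_gt0 c0 expn_gt0 prime_gt0.
  move=> x; rewrite hO; split=> -[a [y hy ->]]; exists a, y => //.
    by apply/(mem_OK RE).
  by apply/(mem_OK RE).
have h1 d : suborder (O d) (O d.+1) l 1.
  by apply: suborder_conductor (hO d) (hO d.+1) _; rewrite expnS expn1; lia.
have h2 d : suborder (O d) (O d.+2) l 2.
  by apply: suborder_conductor (hO d) (hO d.+2) _; rewrite !expnS expn0; lia.
have lcl d : (l %| (c * l ^ d.+1)%N%:Z)%Z by rewrite dvdzE /= dvdn_mull // expnS dvdn_mulr.
have lT d : (l %| ((c * l ^ d.+1)%N%:Z * t)%R)%Z by apply: dvdz_mulr.
have lN d : (l %| ((c * l ^ d.+1)%N%:Z ^+ 2 * n)%R)%Z by rewrite expr2 -mulrA dvdz_mulr.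
have small d : rk l (S d.+2) = rk l (S d.+1) \/ rk l (S d.+2) = rk l (S d.+1) + 1.
  exact: (rk_step_ramified l_prime (h1 d.+1) (hS _) (hS _) (gO d.+1) (lN d)).
(* A generator of [O d] with trace and norm divisible by l controls the step one level up, from
   [O d.+1] to [O d.+2]. *)
have powers d w' t' n' : qo_gen (O d) w' t' n' -> (l %| t')%Z -> (l %| n')%Z ->
    (l = 3%N -> ~~ (9 %| 3 + 3 * t' + t' ^+ 2 - n')%Z)%R -> rk l (S d.+2) = rk l (S d.+1).
  move=> g' lt' ln' h3; apply: (rk_step_eq l_prime (hO := h1 d.+1)) => // x.
  exact: (class_ext_ker_powers l_prime g' l_ge3 lt' ln' h3 (h1 d) (h2 d)).
have stable d : rk l (S d.+3) = rk l (S d.+2).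
  (* For l = 3 the factor c l^(d+1) is divisible by 3, so all terms of the tested sum other than 3
     are divisible by 9. *)
  apply: (powers d.+1 _ _ _ (gO d.+1) (lT d) (lN d)) => l_3.
  have [q eq] := dvdzP (lcl d); rewrite eq l_3; apply/negP => /dvdzP [s].
  have -> : ((q * 3%:Z) ^+ 2 * n = 9 * (q ^+ 2 * n))%R by rewrite -[3%:Z]/(3 : int)%R; ring.
  have -> : ((q * 3%:Z * t) ^+ 2 = 9 * (q * t) ^+ 2)%R by rewrite -[3%:Z]/(3 : int)%R; ring.
  have -> : (3 * (q * 3%:Z * t) = 9 * (q * t))%R by rewrite -[3%:Z]/(3 : int)%R; ring.
  lia.
have from2 d : 2 <= d -> rk l (S d) = rk l (S 2).
  by case: d => [|[|d]] // _; elim: d => // d <-; apply: stable.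
have ram : ramified_prime K l -> exists w' t' n', [/\ qo_gen (O 0) w' t' n', (l %| t')%Z,
    (l %| n')%Z & (t' ^+ 2 - 4 * n' = c%:Z ^+ 2 * (t ^+ 2 - 4 * n))%R].
  move=> /(ramified_dvd_disc RE gw l_prime) ld; have [h eh] := half_odd l_prime l_ge3.
  have := gO 0; rewrite expn0 muln1 => g0.
  (* With l = 2h + 1 this shift turns the trace ct into ct + 2hct = lct. *)
  pose k := (h%:Z * (c%:Z * t))%R; have g1 := qo_gen_shift g0 k.
  have lt' : (l %| (c%:Z * t + 2 * k)%R)%Z.
    by apply/dvdzP; exists (c%:Z * t)%R; rewrite eh PoszD PoszM /k; ring.
  have ed : ((c%:Z * t + 2 * k) ^+ 2 - 4 * (c%:Z ^+ 2 * n + c%:Z * t * k + k ^+ 2) =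
    c%:Z ^+ 2 * (t ^+ 2 - 4 * n))%R by ring.
  exists (c%:R * w + k%:~R)%R, (c%:Z * t + 2 * k)%R, (c%:Z ^+ 2 * n + c%:Z * t * k + k ^+ 2)%R; split=> //.
  (* Four times the new norm is the square of the new trace minus c^2 (t^2 - 4n), both divisible by
     the odd prime l. *)
  have : (l %| (2 * 2 * (c%:Z ^+ 2 * n + c%:Z * t * k + k ^+ 2))%R)%Z.
    have -> : (2 * 2 * (c%:Z ^+ 2 * n + c%:Z * t * k + k ^+ 2) =
      (c%:Z * t + 2 * k) ^+ 2 - c%:Z ^+ 2 * (t ^+ 2 - 4 * n))%R by ring.
    by rewrite rpredB // ?dvdz_mull // expr2 dvdz_mull.
  by rewrite !dvdz_primeM // orbb => /orP[|//]; rewrite dvdzE /= => /dvdn_leq -/(_ isT); rewrite leqNgt l_ge3.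
have unram : split_prime K l \/ inert_prime K l -> rk l (S 1) = rk l (S 0).
  move=> /(split_inert_disc RE gw l_prime l_ge3) ld.
  apply: (rk_step_eq l_prime (hO := h1 0)) => // x.
  apply: (class_ext_ker_unramified l_prime (gO 0)).
  rewrite expn0 muln1.
  (* The generator of [O 0] has discriminant c^2 (t^2 - 4n), and c is prime to l. *)
  have -> : ((c%:Z * t) ^+ 2 - 4 * (c%:Z ^+ 2 * n) = c%:Z * (c%:Z * (t ^+ 2 - 4 * n)))%R by ring.
  by rewrite !dvdz_primeM // !negb_or lc.
have small0 : ramified_prime K l -> rk l (S 1) = rk l (S 0) \/ rk l (S 1) = rk l (S 0) + 1.
  case/ram => w' [t' [n' [g' _ ln' _]]].
  exact: (rk_step_ramified l_prime (h1 0) (hS _) (hS _) g' ln').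
split.
- by move=> /unram e; split=> //; rewrite -e; apply: small.
- move=> rl hl; split; first exact: small0.
  have e21 : rk l (S 2) = rk l (S 1).
    have [w' [t' [n' [g' lt' ln' ed]]]] := ram rl.
    (* The condition at l = 3 comes from D = 3 modulo 9; it is vacuous for l >= 5. *)
    apply: (powers 0 _ _ _ g' lt' ln') => l_3.
    case: hl => [|[_ D9]]; first by rewrite l_3.
    have [k eD] := discriminant_square hD RE gw injQ.
    by rewrite l_3 in lt' lc; apply: (disc_mod9 lc lt' D9 eD ed).
  by case=> [|[|d]] // _; rewrite from2.
- by move=> rl l_3 _; split=> //; apply: small0.
Qed.
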